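(* Let $X$ be a Banach space with $n(X)>0$. (1) For each $T\in\mathcal{L}_v(X)$, $\rho_v\left(T,B_{\mathcal{K}_v(X)}\right)=v(T)+1$. (2) If $T\in\mathcal{L}_v(X)$ attains its numerical radius, then $T$ has a farthest point in $B_{\mathcal{K}_v(X)}$. (3) If $\mathcal{K}_v(X)$ is an M-ideal in $\mathcal{L}_v(X)$ and $T\in\mathcal{L}_v(X)$ has a farthest point in $B_{\mathcal{K}_v(X)}$, then $T^*$ attains its numerical radius.
   Context: Banach spaces are over $\mathbb{K}=\mathbb{R}$ or $\mathbb{C}$; $B_X$ and $S_X$ denote the closed unit ball and the unit sphere of $X$. $\mathcal{L}(X)$ is the space of bounded linear operators on $X$ and $\mathcal{K}(X)$ its subspace of compact operators. Put $\Pi(X)=\{(x^*,x)\in S_{X^*}\times S_X: x^*(x)=1\}$. The numerical radius of $T\in\mathcal{L}(X)$ is $v(T)=\sup\{|x^*(Tx)|:(x^*,x)\in\Pi(X)\}$, and $T$ attains its numerical radius if $|x^*(Tx)|=v(T)$ for some $(x^*,x)\in\Pi(X)$; these notions are applied likewise to $T^*\in\mathcal{L}(X^* )$, with $\Pi(X^* )\subseteq S_{X^{**}}\times S_{X^*}$. The numerical index of $X$ is $n(X)=\inf\{v(T):T\in\mathcal{L}(X),\ \|T\|=1\}$. If $n(X)>0$, then $v$ is a norm on $\mathcal{L}(X)$ equivalent to the operator norm; $\mathcal{L}_v(X)$ and $\mathcal{K}_v(X)$ denote $\mathcal{L}(X)$ and $\mathcal{K}(X)$ equipped with the norm $v$,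 so $B_{\mathcal{K}_v(X)}=\{K\in\mathcal{K}(X):v(K)\le 1\}$. For $T\in\mathcal{L}_v(X)$ and $C\subseteq\mathcal{L}_v(X)$, $\rho_v(T,C)=\sup\{v(T-K):K\in C\}$, and $T$ has a farthest point in $C$ if there is $K\in C$ with $v(T-K)=\rho_v(T,C)$. A closed subspace $J$ of a Banach space $Z$ is an M-ideal in $Z$ if $Z^*=J^*\oplus_1 J^\perp$, i.e. the annihilator $J^\perp$ is the kernel of a linear projection $P$ on $Z^*$ with $\|z^*\|=\|Pz^*\|+\|z^*-Pz^*\|$ for all $z^*\in Z^*$ (the range of $P$ then being identified isometrically with $J^*$). *)

(* Defs.v *)
From HB Require Import structures.
From mathcomp Require Import all_boot all_order all_algebra.
From mathcomp Require Import complex.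
From mathcomp Require Import all_classical reals topology normedtype.

Set Implicit Arguments.
Unset Strict Implicit.
Unset Printing Implicit Defensive.

Import Order.TTheory GRing.Theory Num.Theory.
Import numFieldNormedType.Exports.

Local Open Scope classical_set_scope.
Local Open Scope ring_scope.

Variant scalar_kind := RealScalars | ComplexScalars.

Definition scalar_field (R : realType) (k : scalar_kind) : numFieldType :=
  match k with RealScalars => R | ComplexScalars => R[i] end.

Definition realpart (R : realType) (k : scalar_kind) : scalar_field R k -> R :=
  match k return scalar_field R k -> R with
  | RealScalars => id
  | ComplexScalars => @complex.Re R
  end.

Definition ofreal (R : realType) (k : scalar_kind) : R -> scalar_field R k :=
  match k return R -> scalar_field R k with
  | RealScalars => id
  | ComplexScalars => fun x => Complex x 0
  end.

(* In a normedModType K the norm takes its values in K; over K = R[i] these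
   values are real, and rnorm is the same norm with values in R. *)
Definition rnorm (R : realType) (k : scalar_kind)
  (V : normedModType (scalar_field R k)) (x : V) : R := realpart `|x|.

Section scalar_field_lemmas.
Context {R : realType} {k : scalar_kind}.
Local Notation K := (scalar_field R k).

Lemma ofrealK : cancel (@ofreal R k) (@realpart R k).
Proof. by case: k. Qed.

Lemma ofreal0 : ofreal k 0 = 0 :> K.
Proof. by case: k. Qed.

Lemma ofrealD (a b : R) : ofreal k (a + b) = ofreal k a + ofreal k b.
Proof. by case: k => //=; exact: (raddfD (real_complex R)). Qed.

Lemma ofrealM (a b : R) : ofreal k (a * b) = ofreal k a * ofreal k b.
Proof. by case: k => //=; exact: (rmorphM (real_complex R)). Qed.

Lemma ler_ofreal (a b : R) : (ofreal k a <= ofreal k b) = (a <= b).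
Proof. by case: k => //=; rewrite lecR. Qed.

Lemma real_realpartK (a : K) : a \is Num.real -> ofreal k (realpart a) = a.
Proof. by case: k a => // a; apply: RRe_real. Qed.

Lemma ofreal_rnorm (V : normedModType K) (x : V) :
  ofreal k (rnorm x) = `|x|.
Proof. by rewrite real_realpartK// normr_real. Qed.

Lemma rnorm_ge0 (V : normedModType K) (x : V) : 0 <= rnorm x.
Proof. by rewrite -ler_ofreal ofreal_rnorm ofreal0. Qed.

Lemma ler_rnormD (V : normedModType K) (x y : V) :
  rnorm (x + y) <= rnorm x + rnorm y.
Proof. by rewrite -ler_ofreal ofrealD !ofreal_rnorm ler_normD. Qed.

Lemma ofreal_inj : injective (@ofreal R k).
Proof. exact: can_inj ofrealK. Qed.

Lemma rnorm_scalarM (a b : K^o) : rnorm (a * b : K^o) = rnorm a * rnorm b.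
Proof. by apply: ofreal_inj; rewrite ofrealM !ofreal_rnorm normrM. Qed.

Lemma rnormZ (V : normedModType K) (a : K^o) (x : V) :
  rnorm (a *: x) = rnorm a * rnorm x.
Proof. by apply: ofreal_inj; rewrite ofrealM !ofreal_rnorm normrZ. Qed.

Lemma rnorm_eq0 (V : normedModType K) (x : V) : rnorm x = 0 -> x = 0.
Proof.
by move=> x0; apply/normr0_eq0; rewrite -ofreal_rnorm x0 ofreal0.
Qed.

Lemma rnorm0 (V : normedModType K) : rnorm (0 : V) = 0.
Proof. by apply: ofreal_inj; rewrite ofreal_rnorm normr0 ofreal0. Qed.

Lemma rnorm_ofreal (a : R) : 0 <= a -> rnorm (ofreal k a : K^o) = a.
Proof.
move=> a0; apply: ofreal_inj; rewrite ofreal_rnorm ger0_norm//.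
by rewrite -ofreal0 ler_ofreal.
Qed.

End scalar_field_lemmas.

Section bounded_op.
Context {K : numFieldType} (X Y : normedModType K).

Definition bounded_linear : {pred X -> Y} := fun f =>
  `[< linear f /\ exists M : K, forall x, `|f x| <= M * `|x| >].

Record bounded_op : Type := BoundedOp {
  bounded_op_fun :> X -> Y ;
  bounded_op_subproof : bounded_op_fun \in bounded_linear }.

HB.instance Definition _ := [isSub for bounded_op_fun].
HB.instance Definition _ := [Choice of bounded_op by <:].

Lemma bounded_linear_submod : submod_closed bounded_linear.
Proof.
split.
  apply/asboolP; split; first by move=> a x y /=; rewrite scaler0 addr0.
  by exists 0 => x /=; rewrite normr0 mul0r.
move=> a f g /asboolP[lf [M fM]] /asboolP[lg [N gN]].
have fgE x : (a *: f + g) x = a *: f x + g x by [].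
apply/asboolP; split.
  move=> b x y; rewrite !fgE lf lg.
  by rewrite !scalerDr !scalerA addrACA (mulrC a).
exists (`|a| * M + N) => x; rewrite fgE.
rewrite (le_trans (ler_normD _ _))// normrZ mulrDl lerD// -mulrA.
by rewrite ler_wpM2l.
Qed.

HB.instance Definition _ :=
  GRing.isSubmodClosed.Build K (X -> Y) bounded_linear bounded_linear_submod.
HB.instance Definition _ := [SubChoice_isSubLmodule of bounded_op by <:].

Lemma bounded_op_is_linear (T : bounded_op) : linear T.
Proof. by case: T => f /= /asboolP[]. Qed.

HB.instance Definition _ (T : bounded_op) :=
  GRing.isLinear.Build K X Y *:%R T (bounded_op_is_linear T).

Lemma bounded_opP (T : bounded_op) : exists M : K, forall x, `|T x| <= M * `|x|.
Proof. by case: T => f /= /asboolP[]. Qed.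

Lemma bounded_op_ext (S T : bounded_op) : S =1 T -> S = T.
Proof. by move=> ST; apply/val_inj/funext. Qed.

End bounded_op.
Arguments bounded_linear {K} X Y _.

Section sup_image.
Context {R : realType} (T : Type) (P : set T) (f : T -> R).

Lemma sup_image_le (M : R) : 0 <= M -> (forall x, P x -> f x <= M) ->
  sup [set f x | x in P] <= M.
Proof.
move=> M0 fM; have [->|/set0P [x Px]] := eqVneq P set0.
  by rewrite image_set0 sup0.
by apply: ge_sup; [exists (f x), x|move=> _ [y Py <-]; exact: fM].
Qed.

Lemma le_sup_image (M : R) x : (forall y, P y -> f y <= M) -> P x ->
  f x <= sup [set f y | y in P].
Proof.
move=> fM Px; apply: ub_le_sup; last by exists x.
by exists M => _ [y Py <-]; exact: fM.
Qed.

Lemma sup_image_ge0 (M : R) : (forall x, P x -> f x <= M) ->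
  (forall x, 0 <= f x) -> 0 <= sup [set f x | x in P].
Proof.
move=> fM f0; have [->|/set0P [x Px]] := eqVneq P set0.
  by rewrite image_set0 sup0.
by apply: le_trans (f0 x) _; exact: le_sup_image fM Px.
Qed.

End sup_image.

Section operator_norm.
Context {R : realType} {k : scalar_kind}.
Local Notation K := (scalar_field R k).
Variables X Y : normedModType K.
Implicit Types S T : bounded_op X Y.

Definition opnorm T : R := sup [set rnorm (T x) | x in [set x | rnorm x <= 1]].

Lemma bounded_op_rnorm T :
  exists2 M : R, 0 <= M & forall x, rnorm (T x) <= M * rnorm x.
Proof.
have [M TM] := bounded_opP T.
have aM (x : X) : M * `|x| <= `|M| * `|x|.
  have [->|x0] := eqVneq x 0; first by rewrite normr0 !mulr0.
  rewrite ler_pM2r ?normr_gt0//; apply: real_ler_norm.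
  have := le_trans (normr_ge0 _) (TM x).
  by rewrite pmulr_lge0 ?normr_gt0//; exact: ger0_real.
exists (rnorm (M : K^o)) => [|x]; first exact: rnorm_ge0.
by rewrite -(@ler_ofreal R k) ofrealM !ofreal_rnorm (le_trans (TM x))// aM.
Qed.

Lemma opnorm_ub T : exists M : R, forall x, rnorm x <= 1 -> rnorm (T x) <= M.
Proof.
have [M M0 TM] := bounded_op_rnorm T; exists M => x x1.
by rewrite (le_trans (TM x))// ler_piMr.
Qed.

Lemma opnorm_ge0 T : 0 <= opnorm T.
Proof.
have [M TM] := opnorm_ub T; apply: (sup_image_ge0 TM) => x.
exact: rnorm_ge0.
Qed.

Lemma rnorm_le_opnorm T x : rnorm (T x) <= opnorm T * rnorm x.
Proof.
have [->|x0] := eqVneq x 0; first by rewrite linear0 !rnorm0 mulr0.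
have nx : 0 < rnorm x.
  by rewrite lt_def rnorm_ge0 andbT; apply: contra_neq x0 => /rnorm_eq0.
have [M TM] := opnorm_ub T.
have xV : rnorm (ofreal k (rnorm x)^-1 : K^o) = (rnorm x)^-1.
  by rewrite rnorm_ofreal// invr_ge0 ltW.
have := le_sup_image (f := fun y => rnorm (T y)) (x := ofreal k (rnorm x)^-1 *: x) TM.
rewrite /= rnormZ xV mulVf ?gt_eqF// => /(_ (lexx _)).
by rewrite linearZ/= rnormZ xV ler_pdivrMl// mulrC.
Qed.

Lemma opnorm_le T (M : R) : 0 <= M ->
  (forall x, rnorm (T x) <= M * rnorm x) -> opnorm T <= M.
Proof.
move=> M0 TM; apply: sup_image_le => //= x x1.
by rewrite (le_trans (TM x))// ler_piMr.
Qed.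

Lemma opnormD S T : opnorm (S + T) <= opnorm S + opnorm T.
Proof.
apply: opnorm_le => [|x]; first by rewrite addr_ge0 ?opnorm_ge0.
by rewrite (le_trans (ler_rnormD _ _))// mulrDl lerD// rnorm_le_opnorm.
Qed.

Lemma opnormZ (a : K) T : opnorm (a *: T) = rnorm (a : K^o) * opnorm T.
Proof.
have le_opnormZ (b : K) S : opnorm (b *: S) <= rnorm (b : K^o) * opnorm S.
  apply: opnorm_le => [|x]; first by rewrite mulr_ge0 ?opnorm_ge0 ?rnorm_ge0.
  by rewrite rnormZ -mulrA ler_wpM2l ?rnorm_ge0 ?rnorm_le_opnorm.
have [->|a0] := eqVneq a 0.
  apply/eqP; rewrite eq_le le_opnormZ rnorm0 mul0r scale0r.
  exact: opnorm_ge0.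
apply/eqP; rewrite eq_le le_opnormZ /=.
rewrite -{1}[T]scale1r -(mulVf a0) -scalerA.
have := le_opnormZ a^-1 (a *: T).
move=> /(ler_wpM2l (rnorm_ge0 (a : K^o))) /le_trans; apply.
rewrite mulrA -rnorm_scalarM mulfV//.
rewrite (_ : rnorm _ = 1) ?mul1r//.
by apply: (@ofreal_inj R k); rewrite ofreal_rnorm normr1; case: (k).
Qed.

Lemma opnorm_eq0 T : opnorm T = 0 -> T = 0.
Proof.
move=> T0; apply: bounded_op_ext => x; apply: rnorm_eq0; apply/eqP.
by rewrite eq_le rnorm_ge0 andbT (le_trans (rnorm_le_opnorm T x))// T0 mul0r.
Qed.

Let norm T : K := ofreal k (opnorm T).

Let norm_triangle S T : norm (S + T) <= norm S + norm T.
Proof. by rewrite -ofrealD ler_ofreal opnormD. Qed.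

Let norm_scale (a : K) T : norm (a *: T) = `|a| * norm T.
Proof. by rewrite /norm opnormZ ofrealM ofreal_rnorm. Qed.

Let norm_eq0 T : norm T = 0 -> T = 0.
Proof.
by move=> T0; apply: opnorm_eq0; apply: (@ofreal_inj R k); rewrite ofreal0.
Qed.

HB.instance Definition _ := Lmodule_isNormed.Build K (bounded_op X Y)
  norm_triangle norm_scale norm_eq0.

Lemma rnorm_opE T : rnorm T = opnorm T.
Proof. exact: ofrealK. Qed.

End operator_norm.

Notation dual X := (bounded_op X (scalar_field _ _)^o).

Section numerical_range.
Context {R : realType} {k : scalar_kind}.
Local Notation K := (scalar_field R k).
Implicit Types X : normedModType K.

(* The set Pi(X), with the functional first. *)
Definition state_pairs X : set (dual X * X) :=
  [set p : dual X * X | [/\ rnorm p.1 = 1, rnorm p.2 = 1 & p.1 p.2 = 1]].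
Arguments state_pairs X _ : clear implicits.

Definition numerical_radius X (T : bounded_op X X) : R :=
  sup ((fun p : dual X * X => rnorm (p.1 (T p.2))) @` state_pairs X).

Definition attains_numerical_radius X (T : bounded_op X X) : Prop :=
  exists2 p : dual X * X, state_pairs X p & rnorm (p.1 (T p.2)) = numerical_radius T.

(* inf set0 = 0, so the index of the null space is 0 and a positive index
   forces X to be nontrivial. *)
Definition numerical_index X : R :=
  inf [set numerical_radius T | T in [set T : bounded_op X X | rnorm T = 1]].

Definition compact_op X : set (bounded_op X X) :=
  [set T | precompact (T @` [set x | rnorm x <= 1])].

Definition adjoint_fun X (T : bounded_op X X) (f : dual X) : X -> K^o :=
  fun x => f (T x).

Lemma adjoint_fun_bounded X (T : bounded_op X X) (f : dual X) :
  adjoint_fun T f \in bounded_linear X K^o.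
Proof.
apply/asboolP; split; first by move=> a x y; rewrite /adjoint_fun !linearP.
exists (ofreal k (opnorm f * opnorm T)) => x.
rewrite -!ofreal_rnorm -ofrealM ler_ofreal (le_trans (rnorm_le_opnorm _ _))//.
by rewrite -mulrA ler_wpM2l ?opnorm_ge0// rnorm_le_opnorm.
Qed.

Definition adjoint_dual X (T : bounded_op X X) (f : dual X) : dual X :=
  BoundedOp (adjoint_fun_bounded T f).

Lemma adjoint_dual_bounded X (T : bounded_op X X) :
  adjoint_dual T \in bounded_linear (dual X) (dual X).
Proof.
apply/asboolP; split; first by move=> a f g; exact: bounded_op_ext.
exists (ofreal k (opnorm T)) => f.
rewrite -!ofreal_rnorm -ofrealM ler_ofreal !rnorm_opE.
apply: opnorm_le => [|x]; first by rewrite mulr_ge0 ?opnorm_ge0.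
rewrite (le_trans (rnorm_le_opnorm f _))// (mulrC (opnorm T)) -mulrA.
by rewrite ler_wpM2l ?opnorm_ge0// rnorm_le_opnorm.
Qed.

Definition adjoint X (T : bounded_op X X) : bounded_op (dual X) (dual X) :=
  BoundedOp (adjoint_dual_bounded T).

Lemma numerical_radius_ub X (T : bounded_op X X) (p : dual X * X) :
  state_pairs X p -> rnorm (p.1 (T p.2)) <= opnorm T.
Proof.
case=> p1 p2 _; rewrite (le_trans (rnorm_le_opnorm _ _))// -rnorm_opE p1 mul1r.
by rewrite (le_trans (rnorm_le_opnorm _ _))// p2 mulr1.
Qed.

Lemma numerical_radius_ge0 X (T : bounded_op X X) : 0 <= numerical_radius T.
Proof.
apply: (sup_image_ge0 (@numerical_radius_ub X T)) => p; exact: rnorm_ge0.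
Qed.

Lemma le_numerical_radius X (T : bounded_op X X) (p : dual X * X) : state_pairs X p ->
  rnorm (p.1 (T p.2)) <= numerical_radius T.
Proof. exact: (le_sup_image (@numerical_radius_ub X T)). Qed.

Lemma numerical_radiusD X (S T : bounded_op X X) :
  numerical_radius (S + T) <= numerical_radius S + numerical_radius T.
Proof.
apply: sup_image_le => [|p Pp]; first by rewrite addr_ge0 ?numerical_radius_ge0.
rewrite [_ p.2]/(S p.2 + T p.2) linearD (le_trans (ler_rnormD _ _))//.
by rewrite lerD// le_numerical_radius.
Qed.

Lemma numerical_radiusZ X (a : K) (T : bounded_op X X) :
  numerical_radius (a *: T) = rnorm (a : K^o) * numerical_radius T.
Proof.
have leZ (b : K) (S : bounded_op X X) :
    numerical_radius (b *: S) <= rnorm (b : K^o) * numerical_radius S.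
  apply: sup_image_le => [|p Pp].
    by rewrite mulr_ge0 ?numerical_radius_ge0 ?rnorm_ge0.
  rewrite [_ p.2]/(b *: S p.2) linearZ/= rnormZ.
  by rewrite ler_wpM2l ?rnorm_ge0// le_numerical_radius.
have [->|a0] := eqVneq a 0.
  apply/eqP; rewrite eq_le leZ rnorm0 mul0r scale0r.
  exact: numerical_radius_ge0.
apply/eqP; rewrite eq_le leZ /=.
rewrite -{1}[T]scale1r -(mulVf a0) -scalerA.
have := leZ a^-1 (a *: T).
move=> /(ler_wpM2l (rnorm_ge0 (a : K^o))) /le_trans; apply.
rewrite mulrA -rnorm_scalarM mulfV//.
rewrite (_ : rnorm _ = 1) ?mul1r//.
by apply: (@ofreal_inj R k); rewrite ofreal_rnorm normr1; case: (k).
Qed.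

Lemma numerical_radius_eq0 X (T : bounded_op X X) :
  0 < numerical_index X -> numerical_radius T = 0 -> T = 0.
Proof.
move=> n0 T0; apply: contrapT => /eqP TN0.
have nT : 0 < opnorm T.
  by rewrite lt_def opnorm_ge0 andbT; apply: contra_neq TN0 => /opnorm_eq0.
have nV : rnorm (ofreal k (opnorm T)^-1 : K^o) = (opnorm T)^-1.
  by rewrite rnorm_ofreal// invr_ge0 ltW.
suff : numerical_index X <= 0 by rewrite leNgt n0.
apply: inf_lbound; first by exists 0 => _ [S _ <-]; exact: numerical_radius_ge0.
exists (ofreal k (opnorm T)^-1 *: T).
  by rewrite /= rnorm_opE opnormZ nV mulVf// gt_eqF.
by rewrite numerical_radiusZ T0 mulr0.
Qed.

End numerical_range.
Arguments state_pairs {R k} X _.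
Arguments compact_op {R k} X _.

(* L(X) with the numerical radius as its norm; the proof that n(X) > 0 is an
   argument of the type because v is a norm only under this hypothesis. *)
Definition numrad_op (R : realType) (k : scalar_kind)
  (X : normedModType (scalar_field R k)) (nX : 0 < numerical_index X) : Type :=
  bounded_op X X.

Section numrad_op.
Context {R : realType} {k : scalar_kind} {X : normedModType (scalar_field R k)}.
Variable nX : 0 < numerical_index X.
Local Notation K := (scalar_field R k).

HB.instance Definition _ := GRing.Lmodule.copy (numrad_op nX) (bounded_op X X).

Let norm (T : numrad_op nX) : K := ofreal k (numerical_radius T).

Let norm_triangle S T : norm (S + T) <= norm S + norm T.
Proof. by rewrite -ofrealD ler_ofreal numerical_radiusD. Qed.

Let norm_scale (a : K) T : norm (a *: T) = `|a| * norm T.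
Proof. by rewrite /norm numerical_radiusZ ofrealM ofreal_rnorm. Qed.

Let norm_eq0 T : norm T = 0 -> T = 0.
Proof.
move=> T0; apply: (numerical_radius_eq0 nX).
by apply: (@ofreal_inj R k); rewrite ofreal0.
Qed.

HB.instance Definition _ := Lmodule_isNormed.Build K (numrad_op nX)
  norm_triangle norm_scale norm_eq0.

Lemma rnorm_numradE (T : numrad_op nX) : rnorm T = numerical_radius T.
Proof. exact: ofrealK. Qed.

Definition numrad_compact : set (numrad_op nX) := compact_op X.

Definition numrad_compact_ball : set (numrad_op nX) :=
  [set T | numrad_compact T /\ rnorm T <= 1].

End numrad_op.
Arguments numrad_compact {R k X} nX _.
Arguments numrad_compact_ball {R k X} nX _.

Section normed_space_geometry.
Context {R : realType} {k : scalar_kind} {Z : normedModType (scalar_field R k)}.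
Local Notation K := (scalar_field R k).
Implicit Types (z : Z) (C J : set Z).

Definition farthest_dist z C : R := sup [set rnorm (z - c) | c in C].

Definition has_farthest_point z C : Prop :=
  exists2 c, C c & rnorm (z - c) = farthest_dist z C.

Definition closed_subspace J : Prop :=
  [/\ closed J, J 0 & forall (a : K) x y, J x -> J y -> J (a *: x + y)].

Definition annihilator J : set (dual Z) :=
  [set f | forall z, J z -> f z = 0].

(* Z^* = J^* (+)_1 J^perp. The range of P is then isometric to J^* by
   restriction, so it is not constrained further. *)
Definition M_ideal J : Prop :=
  closed_subspace J /\
  exists P : {linear dual Z -> dual Z},
    [/\ forall f, P (P f) = P f,
        [set f | P f = 0] = annihilator J &
        forall f, rnorm f = rnorm (P f) + rnorm (f - P f)].

End normed_space_geometry.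

(* Main.v *)
From HB Require Import structures.
Require Import Defs.
From mathcomp Require Import all_boot all_order all_algebra.
From mathcomp Require Import complex.
From mathcomp Require Import all_classical reals topology normedtype.
From mathcomp Require Import ring lra.

(** Farthest points are produced by operators of rank one: at a state pair
    (y, x), the operator sending z to c y(z) x, with c unimodular and of phase
    opposite to y(Tx), has numerical radius at most one and moves the value
    |y(Tx)| up by one ([rank_one_far]). This gives the first two parts.

    For the third part, write X' and X'' for the dual and the bidual and S' for
    the adjoint of S. Let c be a farthest point and let state pairs (y_p, x_p)
    approximate v(T - c) = v(T) + 1. Along an ultrafilter they converge
    pointwise to y in X' and n in X'', and the values y_p(S x_p) converge to
    phi(S), where phi has norm at most one on the operators, |phi(T)| = v(T)
    and |phi(c)| = 1. Since c is compact, the norm of phi is already attained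
    on the compact operators, so the M-projection P fixes phi. On a compact S,
    phi(S) equals n(S' y), the value of the elementary functional n (x) y,
    because S' maps the pointwise null family w_p = y_p - y to a norm null
    family ([adjoint_compact_vanish]). If n(y) = 1, then (n, y) is a state pair
    of X', the functional n (x) y has norm at most one and the same projection
    as phi, hence equals phi, and T' attains its numerical radius at (n, y).

    The point is therefore to show n(y) = 1 ([limit_pair_state]): a priori a
    part of the mass could be lost in w_p. Let G be the operator on X'' given
    by (G m)(z) = P(m (x) z)(id) - m(z). For the limit pair, Re (G n)(y) is
    d = 1 - Re n(y), and d has to vanish. Three facts are combined.

    - G is skew: |m + s G m| >= |m| for all real s ([defect_skew]). Indeed if
      m nearly attains its norm at z, then m (x) z has norm nearly |m| |z|, a
      value that the compact operators already detect, so P nearly fixes it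
      and (G m)(z) is nearly zero.

    - Let N(z) be the limit of |z + w_p| and H its conjugate on the unit ball
      of X'', H(m) = sup_z Re m(z) - N(z), so that -2 <= H <= 0. If z is almost
      optimal for m, then |m| |z| <= Re (m + G m)(z) up to a small error
      ([asym_conj_slope]): by the Hahn-Banach theorem m extends to a functional
      on the pairs (z, S) below the limit of |z + S' w_p|, and this yields an
      almost state on the operators that agrees with m (x) z on the compact
      ones; the norm identity of P does the rest. In particular H does not
      decrease in the direction G m, and where its derivative in this direction
      is small, its slope z almost norms m.

    - Consequently H takes the same value at points of equal norm, at least
      where G does not vanish ([skew_le]). Since G is skew, the flow exp(tG)
      is isometric, and H increases along it within bounds, so for most times
      the derivative along G is small. At such times the slope almost norms the
      point, hence H is almost constant along a path on the sphere. Averaging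
      over long times makes the errors disappear.

    Now compare n with (1 + hG) n, both scaled to the same norm slightly less
    than one. Normalizing the second costs only a term of order h^2, as G is
    skew, while the slope y makes H grow by h d. As H agrees at both points,
    d <= C h for every h > 0, so d <= 0. *)

Set Implicit Arguments.
Unset Strict Implicit.
Unset Printing Implicit Defensive.

Import Order.TTheory GRing.Theory Num.Theory.
Import numFieldNormedType.Exports.

Local Open Scope classical_set_scope.
Local Open Scope ring_scope.

(** * Skew operators and functions constant on spheres *)

Section skew_flow.
Context {R : realType} {V : lmodType R}.
Variables (nrm : V -> R) (G : {linear V -> V}) (g B : R) (H : V -> R).
Hypothesis nrmD : forall x y, nrm (x + y) <= nrm x + nrm y.
Hypothesis nrmZ : forall a x, nrm (a *: x) = `|a| * nrm x.
Hypothesis nrmG : forall x, nrm (G x) <= g * nrm x.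
Hypothesis g0 : 0 <= g.
Hypothesis skewG : forall s x, nrm x <= nrm (x + s *: G x).
Hypothesis B0 : 0 <= B.
Hypothesis H_le0 : forall n, nrm n < 1 -> H n <= 0.
Hypothesis H_ge : forall n, nrm n < 1 -> - B <= H n.

(** The first half says that l is an e-subgradient of H at n; the second that
    l takes its maximum over the ball of radius nrm n almost at n, up to its
    derivative in the direction G n. *)
Definition slope (e : R) (n : V) (l : {scalar V}) : Prop :=
  (forall n', nrm n' < 1 -> H n + l (n' - n) - e <= H n') /\
  (forall q, nrm q <= nrm n -> l q <= l n + l (G n) + e).

Hypothesis slopes : forall n e, nrm n < 1 -> 0 < e -> exists l, slope e n l.

Lemma nrm0 : nrm 0 = 0.
Proof. by rewrite -(scale0r 0) nrmZ normr0 mul0r. Qed.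

Lemma nrmN x : nrm (- x) = nrm x.
Proof. by rewrite -scaleN1r nrmZ normrN1 mul1r. Qed.

Lemma nrm_ge0 x : 0 <= nrm x.
Proof. by have := nrmD x (- x); rewrite subrr nrm0 nrmN; lra. Qed.

Lemma nrmB x y : nrm (x - y) <= nrm x + nrm y.
Proof. by rewrite -(nrmN y) nrmD. Qed.

Lemma nrm_distC x y : nrm (x - y) = nrm (y - x).
Proof. by rewrite -nrmN opprB. Qed.

Lemma nrm_le_dist x y : nrm x <= nrm y + nrm (x - y).
Proof. by have := nrmD y (x - y); rewrite addrC subrK. Qed.

Lemma nrmZp a x : 0 <= a -> nrm (a *: x) = a * nrm x.
Proof. by move=> a0; rewrite nrmZ ger0_norm. Qed.

Lemma slope_GE e n l : slope e n l -> - e <= l (G n).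
Proof. by case=> _ /(_ n (lexx _)); lra. Qed.

Lemma slope_scaled e n l v c : slope e n l -> 0 < c -> nrm v <= c * nrm n ->
  l v <= c * (l n + l (G n) + e).
Proof.
move=> sl c0 vc.
have := sl.2 (c^-1 *: v); rewrite nrmZp ?invr_ge0 ?(ltW c0)// ler_pdivrMl//.
by move=> /(_ vc); rewrite scalarZ ler_pdivrMl.
Qed.

Section radius.
Variable r1 : R.
Hypothesis r1_lt1 : r1 < 1.

Let sigma := (1 - r1) / 2.
Definition slope_bound := (B + 1) / sigma.
Local Notation Lam := slope_bound.

Lemma slope_bound_ge0 : 0 <= Lam.
Proof.
have b1 : 0 <= B + 1 by move: B0; lra.
have b2 : 0 <= (1 - r1) / 2 by move: r1_lt1; lra.
exact: divr_ge0.
Qed.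

(** H oscillates by at most B, the slope error is at most 1, and one can move from n by sigma in every
    direction without leaving the unit ball. *)
Lemma slope_le e n l v : e <= 1 -> slope e n l -> nrm n <= r1 -> nrm v <= 1 ->
  l v <= Lam.
Proof.
move=> e1 sl n1 v1.
have s0 : 0 < sigma by rewrite /sigma; move: r1_lt1; lra.
rewrite /slope_bound ler_pdivlMr// mulrC -scalarZ.
have nv : nrm (n + sigma *: v) < 1.
  have := nrmD n (sigma *: v); rewrite nrmZp ?(ltW s0)//.
  have : sigma * nrm v <= sigma by rewrite ler_piMr// (ltW s0).
  by rewrite /sigma; move: r1_lt1; lra.
have n11 : nrm n < 1 by move: r1_lt1; lra.
have := sl.1 _ nv; rewrite [X in l X]addrAC subrr add0r.
by have := H_le0 nv; have := H_ge n11; lra.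
Qed.

Lemma H_lipschitz e n n' : nrm n <= r1 -> nrm n' <= r1 -> 0 < e ->
  nrm (n - n') <= e -> H n <= H n' + Lam * e.
Proof.
move=> n1 n1' e0 nn'.
apply/ler_addgt0Pr => d d0.
pose d' := Num.min d 1.
have d'0 : 0 < d' by rewrite lt_min d0 ltr01.
have [dd d1] : d' <= d /\ d' <= 1 by rewrite !ge_min !lexx orbT.
have [l sl] := slopes (le_lt_trans n1 r1_lt1) d'0.
have := sl.1 _ (le_lt_trans n1' r1_lt1).
have : l (n - n') <= Lam * e.
  rewrite -ler_pdivrMr// mulrC -scalarZ.
  apply: (slope_le d1 sl n1); rewrite nrmZp ?invr_ge0 ?(ltW e0)//.
  by rewrite ler_pdivrMl// mulr1.
rewrite -opprB linearN/=; lra.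
Qed.

End radius.

Section discrete_flow.
Variable h : R.
Hypothesis h0 : 0 < h.

(** The Euler scheme with step h for exp(tG). *)
Definition flow j := iter j (fun x => x + h *: G x).

(** Bounds the growth of norms in j Euler steps. *)
Definition growth j := (1 + h ^+ 2 * g ^+ 2) ^+ j.

Lemma flow_linear j a x y : flow j (a *: x + y) = a *: flow j x + flow j y.
Proof.
elim: j => //= j ->; rewrite linearP/= !scalerDr !scalerA (mulrC h a) -!addrA.
by congr (_ + _); rewrite addrCA.
Qed.

Lemma flowD j x y : flow j (x + y) = flow j x + flow j y.
Proof. by have := flow_linear j 1 x y; rewrite !scale1r. Qed.

Lemma flow0 j : flow j 0 = 0.
Proof. by elim: j => //= j ->; rewrite linear0 scaler0 addr0. Qed.

Lemma flowZ j a x : flow j (a *: x) = a *: flow j x.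
Proof. by have := flow_linear j a x 0; rewrite flow0 !addr0. Qed.

(** Applying 1 - sG, which does not decrease norms, to (1 + sG)x gives
    x - s^2 G^2 x: the growth is of second order in s. *)
Lemma nrm_step s x : nrm (x + s *: G x) <= (1 + s ^+ 2 * g ^+ 2) * nrm x.
Proof.
apply: (le_trans (skewG (- s) _)).
have -> : x + s *: G x + - s *: G (x + s *: G x) = x - s ^+ 2 *: G (G x).
  rewrite linearD linearZ/= scalerDr addrA -(addrA x) scaleNr subrr addr0.
  by rewrite scalerA mulNr scaleNr.
rewrite (le_trans (nrmB _ _))// mulrDl mul1r lerD2l nrmZp ?sqr_ge0//.
rewrite -mulrA ler_wpM2l ?sqr_ge0// (le_trans (nrmG _))//.
by rewrite expr2 -mulrA ler_wpM2l.
Qed.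

Lemma growth_mono i j : (i <= j)%N -> growth i <= growth j.
Proof.
by move=> ij; rewrite ler_weXn2l// lerDl mulr_ge0 ?sqr_ge0.
Qed.

Lemma flow_ge j x : nrm x <= nrm (flow j x).
Proof. by elim: j => //= j IH; exact: le_trans IH (skewG _ _). Qed.

Lemma flow_le j x : nrm (flow j x) <= growth j * nrm x.
Proof.
elim: j => [|j IH]; first by rewrite /growth expr0 mul1r.
rewrite /= /growth exprS -mulrA; apply: le_trans (nrm_step _ _) _.
by apply: ler_wpM2l => //; rewrite addr_ge0// mulr_ge0 ?sqr_ge0.
Qed.

Lemma flow_comm j x : flow j (G x) = G (flow j x).
Proof. by elim: j => //= j ->; rewrite linearD linearZ. Qed.

End discrete_flow.

Lemma growthN h j : growth (- h) j = growth h j.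
Proof. by rewrite /growth sqrrN. Qed.

(** (1 + hG)(1 - hG) = 1 - h^2 G^2, so that flowing back and forth returns to
    the starting point up to the growth bound. *)
Lemma flow_backK h j x (z := fun j => flow h j (flow (- h) j x)) :
  nrm (z j) <= growth h j * nrm x /\ nrm (z j - x) <= (growth h j - 1) * nrm x.
Proof.
elim: j => [|j [IH1 IH2]].
  by rewrite /z /= subrr nrm0 /growth expr0 mul1r subrr mul0r.
have zS : z j.+1 = z j - h ^+ 2 *: G (G (z j)).
  rewrite {1}/z /flow iterSr -/(flow h j) /= -/(flow (- h) j) -/(flow (- h) j x).
  set y := flow (- h) j x.
  rewrite linearD linearZ/= scalerDr addrA -(addrA y) scaleNr addNr addr0.
  by rewrite scaleNr scalerN scalerA -expr2 -scaleNr flowD flowZ !flow_comm scaleNr.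
have GG : nrm (h ^+ 2 *: G (G (z j))) <= h ^+ 2 * g ^+ 2 * (growth h j * nrm x).
  rewrite nrmZp ?sqr_ge0// -mulrA ler_wpM2l ?sqr_ge0//.
  apply: (le_trans (nrmG _)); rewrite expr2 -mulrA ler_wpM2l//.
  by apply: (le_trans (nrmG _)); rewrite ler_wpM2l.
have dS : growth h j.+1 = growth h j + h ^+ 2 * g ^+ 2 * growth h j.
  by rewrite /growth exprS mulrDl mul1r.
split; rewrite zS dS.
  apply: (le_trans (nrmB _ _)); rewrite mulrDl -[X in _ <= _ + X]mulrA.
  exact: lerD.
rewrite addrAC; apply: (le_trans (nrmB _ _)).
by rewrite addrAC mulrDl -[X in _ <= _ + X]mulrA; apply: lerD.
Qed.

Section segment.
Variables (h rho eta eps r1 : R) (J : nat).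
Hypothesis h0 : 0 < h.
Hypothesis rho0 : 0 < rho.
Hypothesis r1_lt1 : r1 < 1.
Hypothesis eta01 : 0 <= eta <= 1.
Hypothesis eps01 : 0 < eps <= 1.
Hypothesis growthJ : growth h J <= 1 + eta.
Hypothesis rho_r1 : (1 + eta) * rho <= r1.
Local Notation Lam := (slope_bound r1).
Local Notation fl := (flow h).

Lemma growth_le j : (j <= J)%N -> growth h j <= 1 + eta.
Proof. by move=> /(growth_mono h) /le_trans; apply. Qed.

Lemma flow_le_eta j x : (j <= J)%N -> nrm (fl j x) <= (1 + eta) * nrm x.
Proof.
move=> jJ; apply: (le_trans (flow_le _ _ _)).
by rewrite ler_wpM2r ?nrm_ge0// growth_le.
Qed.

Lemma flow_le_r1 j x : (j <= J)%N -> nrm x <= rho -> nrm (fl j x) <= r1.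
Proof.
move=> jJ xr; apply: (le_trans (flow_le_eta _ jJ)); apply: le_trans rho_r1.
by rewrite ler_wpM2l//; case/andP: eta01; lra.
Qed.

Lemma flow_lt1 j x : (j <= J)%N -> nrm x <= rho -> nrm (fl j x) < 1.
Proof. by move=> jJ xr; apply: le_lt_trans r1_lt1; exact: flow_le_r1. Qed.

(** For equally spaced l0, l1, l2 on a line, with p0 and p1 the normalizations
    of l0 and l1, the slope at the image of p1 is almost largest, on the ball
    of radius rho, at p1; testing it at l0 = 2 l1 - l2 shows that H drops little
    towards p0. The error consists of the second difference of the norm along
    the line, of the growth eta of the flow, and of the increment of H in the
    next Euler step, which bounds the derivative in the direction G. *)
Lemma path_step l0 l1 l2 p0 p1 j :
  p0 = (rho / nrm l0) *: l0 -> p1 = (rho / nrm l1) *: l1 -> l0 + l2 = 2 *: l1 -> (j < J)%N ->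
  rho / 4 <= nrm l0 -> 0 < nrm l1 -> rho / 4 <= nrm l2 -> nrm l2 <= 3 ->
  H (fl j p1) - H (fl j p0) <=
    4 / rho * ((nrm l0 - 2 * nrm l1 + nrm l2) * Lam + 3 * eta * Lam +
       6 * ((H (fl j.+1 p1) - H (fl j p1) + eps) / h + eps)) + eps.
Proof.
set a0 := nrm l0; set a1 := nrm l1; set a2 := nrm l2.
move=> p0E p1E l012 jJ a0r a1p a2r a23.
have rhop := rho0; have hp := h0.
have a0p : 0 < a0 by lra.
have a2p : 0 < a2 by lra.
have np1 : nrm p1 = rho.
  by rewrite p1E nrmZp ?divr_ge0 ?(ltW rho0) ?(ltW a1p)// divfK// gt_eqF.
have np0 : nrm p0 = rho.
  by rewrite p0E nrmZp ?divr_ge0 ?(ltW rho0) ?(ltW a0p)// divfK// gt_eqF.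
have [e0 e1] := andP eta01; have [ep0 ep1] := andP eps01.
pose n := fl j p1.
have nr1 : nrm n <= r1 by apply: flow_le_r1; rewrite ?np1 ?(ltnW jJ).
have n1 : nrm n < 1 by exact: le_lt_trans r1_lt1.
have rn : rho <= nrm n by rewrite -np1 flow_ge.
have [l sl] := slopes n1 ep0.
pose X := l n; pose Y := l (G n).
have XL : X <= Lam by apply: (slope_le r1_lt1 ep1 sl nr1); exact: ltW.
have L0 : 0 <= Lam := slope_bound_ge0 r1_lt1.
have Ye : 0 <= Y + eps by have := slope_GE sl; rewrite -/Y; lra.
have hY : Y <= (H (fl j.+1 p1) - H n + eps) / h.
  rewrite ler_pdivlMr// mulrC.
  have lt1 : nrm (fl j.+1 p1) < 1 by apply: flow_lt1; rewrite ?np1.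
  have := sl.1 _ lt1.
  rewrite [fl j.+1 p1]/(n + h *: G n) [X in l X]addrAC subrr add0r scalarZ -/Y.
  by lra.
(* As l almost norms n on its ball, its value at the image of l2 is almost at
   most |l2| / rho times l n; this bounds l at l0 = 2 l1 - l2 from below. *)
pose W := l (fl j l2).
have Wle : rho * W <= (1 + eta) * a2 * (X + Y + eps).
  rewrite mulrC -ler_pdivlMr// mulrAC.
  apply: (slope_scaled sl).
    by rewrite divr_gt0// mulr_gt0//; lra.
  apply: (le_trans (flow_le_eta _ (ltnW jJ))).
  rewrite -[leRHS]mulrA; apply: ler_peMr.
    by rewrite mulr_ge0 ?nrm_ge0//; lra.
  by rewrite mulrC ler_pdivlMr// mul1r.
have lfl1 : l (fl j l1) = a1 / rho * X.
  rewrite /X /n p1E flowZ scalarZ !mulrA divfK ?gt_eqF// divff ?gt_eqF// mul1r//.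
have lfl0 : l (fl j l0) = 2 * (a1 / rho * X) - W.
  have -> : l0 = 2 *: l1 - l2 by rewrite -l012 addrK.
  by rewrite flowD flowZ -scaleN1r flowZ scaleN1r linearB/= scalarZ lfl1.
have lp0 : l (fl j p0) = (2 * a1 * X - rho * W) / a0.
  rewrite p0E flowZ scalarZ lfl0; field.
  by rewrite !gt_eqF.
have lt1 : nrm (fl j p0) < 1 by apply: flow_lt1; rewrite ?np0 ?(ltnW jJ).
have := sl.1 _ lt1.
rewrite linearB/= lp0 -/X => key.
have a012 : 0 <= a0 - 2 * a1 + a2.
  have := nrmD l0 l2; rewrite l012 nrmZ ger0_norm// -/a0 -/a1 -/a2; lra.
set E := (a0 - 2 * a1 + a2) * Lam + 3 * eta * Lam + 6 * (Y + eps).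
have E0 : 0 <= E.
  apply: addr_ge0; last by apply: mulr_ge0.
  apply: addr_ge0; first exact: mulr_ge0.
  by apply: mulr_ge0 => //; lra.
have EE : a0 * X - 2 * a1 * X + rho * W <= E.
  apply: le_trans (_ : a0 * X - 2 * a1 * X + (1 + eta) * a2 * (X + Y + eps) <= _).
    by rewrite lerD2l.
  have i1 : (a0 - 2 * a1 + a2) * X <= (a0 - 2 * a1 + a2) * Lam by rewrite ler_wpM2l.
  have i2 : eta * a2 * X <= 3 * eta * Lam.
    apply: (@le_trans _ _ (eta * a2 * Lam)); first by rewrite ler_wpM2l// mulr_ge0// ltW.
    by rewrite ler_wpM2r// mulrC ler_wpM2r.
  have i3 : (1 + eta) * a2 * (Y + eps) <= 6 * (Y + eps).
    rewrite ler_wpM2r//; apply: (@le_trans _ _ (2 * 3)); last by lra.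
    by apply: ler_pM => //; lra.
  rewrite /E; lra.
have E4 : E / a0 <= 4 / rho * E.
  rewrite mulrC ler_wpM2r// -[4 / rho]invf_div lef_pV2// ?posrE ?divr_gt0//.
have key2 : X - (2 * a1 * X - rho * W) / a0 <= E / a0.
  rewrite -[X in X - _](mulfK (lt0r_neq0 a0p)) -mulrBl ler_wpM2r ?invr_ge0 ?(ltW a0p)//.
  lra.
have : E <= (a0 - 2 * a1 + a2) * Lam + 3 * eta * Lam +
       6 * ((H (fl j.+1 p1) - H (fl j p1) + eps) / h + eps).
  rewrite /E lerD2l ler_wpM2l// lerD2r//.
have r4 : 0 <= 4 / rho by rewrite divr_ge0// ltW.
move=> /(ler_wpM2l r4) big.
apply: (@le_trans _ _ (E / a0 + eps)); last by rewrite lerD2r (le_trans E4).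
by move: key key2; rewrite -/n; move: (_ / a0) (E / a0) => u v; lra.
Qed.

Lemma rho_lt1 : rho < 1.
Proof.
apply: le_lt_trans r1_lt1; apply: le_trans rho_r1.
by rewrite ler_peMl ?(ltW rho0)//; move: eta01 => /andP[]; lra.
Qed.

Definition orbit_sum p := \sum_(j < J) H (fl j p).

Definition step_error s :=
  4 / rho * (J%:R * (s * Lam + 3 * eta * Lam) +
    6 * ((B + J%:R * eps) / h + J%:R * eps)) + J%:R * eps.

Lemma sum_affine (x : nat -> R) (c A e u : R) n :
  \sum_(j < n) (c * (A + 6 * ((x j + e) * u + e)) + e) =
  c * (n%:R * A + 6 * (((\sum_(j < n) x j) + n%:R * e) * u + n%:R * e)) + n%:R * e.
Proof.
elim: n => [|n IH]; first by rewrite !big_ord0; ring.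
by rewrite !big_ord_recr /= IH -natr1; ring.
Qed.

(** Summed over an orbit, the increments of H in the Euler steps telescope to
    at most B, however long the orbit is: this is the gain from averaging. *)
Lemma orbit_sum_step l0 l1 l2 p0 p1 :
  p0 = (rho / nrm l0) *: l0 -> p1 = (rho / nrm l1) *: l1 -> l0 + l2 = 2 *: l1 ->
  rho / 4 <= nrm l0 -> rho / 4 <= nrm l1 -> rho / 4 <= nrm l2 -> nrm l2 <= 3 ->
  orbit_sum p1 - orbit_sum p0 <= step_error (nrm l0 - 2 * nrm l1 + nrm l2).
Proof.
move=> p0E p1E l012 a0r a1r a2r a23.
have rhop := rho0; have hp := h0.
have a1p : 0 < nrm l1 by lra.
have np1 : nrm p1 = rho.
  by rewrite p1E nrmZp ?divr_ge0 ?(ltW rho0) ?(ltW a1p)// divfK// gt_eqF.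
rewrite /orbit_sum -sumrB.
apply: (@le_trans _ _ (\sum_(j < J) (4 / rho * ((nrm l0 - 2 * nrm l1 + nrm l2) * Lam + 3 * eta * Lam +
       6 * ((H (fl j.+1 p1) - H (fl j p1) + eps) / h + eps)) + eps))).
  by apply: ler_sum => j _; exact: (path_step p0E p1E l012).
have tel : \sum_(j < J) (H (fl j.+1 p1) - H (fl j p1)) <= B.
  rewrite -(big_mkord xpredT (fun j => H (fl j.+1 p1) - H (fl j p1))) telescope_sumr//.
  have lt1 : nrm (fl J p1) < 1 by apply: flow_lt1; rewrite ?np1.
  have lt1' : nrm (fl 0 p1) < 1 by apply: flow_lt1; rewrite ?np1.
  by have := H_le0 lt1; have := H_ge lt1'; lra.
rewrite (sum_affine (fun j => H (fl j.+1 p1) - H (fl j p1))) /step_error.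
rewrite lerD2r ler_wpM2l ?divr_ge0 ?(ltW rho0)//.
rewrite lerD2l ler_wpM2l// lerD2r ler_wpM2r ?invr_ge0 ?(ltW h0)//.
by rewrite lerD2r.
Qed.

(** A chord of a sphere, extended beyond its endpoint b, stays away from 0
    unless its endpoints are nearly opposite. *)
Lemma chord_ge a b t : nrm a = rho -> nrm b = rho -> rho <= nrm (a + b) ->
  0 <= t -> rho / 4 <= nrm (a + t *: (b - a)).
Proof.
move=> ar br abr t0; set x := a + _.
have rhop := rho0.
have xE : x = (1 - t) *: a + t *: b.
  by rewrite /x scalerBr scalerBl scale1r addrA addrAC.
have tb : t * rho <= nrm x + `|1 - t| * rho.
  by rewrite -{1}br -ar -nrmZ -(nrmZp _ t0) (le_trans _ (nrmB _ _))// xE addrAC subrr add0r.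
have [t1|t1] := lerP t 1; last first.
  by move: tb; rewrite ltr0_norm; lra.
have ta : (1 - t) * rho <= nrm x + t * rho.
  rewrite -{1}ar -br -!nrmZp//; last by rewrite subr_ge0.
  by rewrite (le_trans _ (nrmB _ _))// xE addrK.
move: tb; rewrite ger0_norm ?subr_ge0// => tb.
have : nrm (a + b) <= 2 * nrm x + `|2 * t - 1| * (2 * rho).
  have -> : a + b = 2 *: x - (2 * t - 1) *: (b - a).
    rewrite xE scalerDr !scalerA scalerBr opprB addrACA -scalerDl -scalerBl.
    have -> : 2 * (1 - t) + (2 * t - 1) = 1 by ring.
    have -> : 2 * t - (2 * t - 1) = 1 by ring.
    by rewrite !scale1r.
  apply: (le_trans (nrmB _ _)); rewrite (nrmZ 2) (nrmZ (2 * t - 1)) (ger0_norm (ler0n _ 2)).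
  rewrite lerD2l ler_wpM2l//.
  by rewrite (le_trans (nrmB _ _))// ar br; lra.
by have [t2|t2] := ger0P (2 * t - 1); lra.
Qed.

Lemma chord_le a b t : nrm a = rho -> nrm b = rho ->
  0 <= t <= 2 -> nrm (a + t *: (b - a)) <= 3.
Proof.
move=> ar br /andP[t0 t2].
have -> : a + t *: (b - a) = (1 - t) *: a + t *: b.
  by rewrite scalerBr scalerBl scale1r addrA addrAC.
have := rho_lt1; have rhop := rho0 => r1'.
have i1 : `|1 - t| * rho <= rho by rewrite ler_piMl ?(ltW rho0)// ler_norml; lra.
have i2 : t * rho <= 2 * rho by rewrite ler_wpM2r// ltW.
apply: (le_trans (nrmD _ _)); rewrite !nrmZ ar br (ger0_norm t0); lra.
Qed.

Lemma sum_step_error (f : nat -> R) k :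
  \sum_(0 <= i < k) step_error (f i) =
  4 / rho * (J%:R * ((\sum_(0 <= i < k) f i) * Lam)
    + k%:R * (J%:R * (3 * eta * Lam) + 6 * ((B + J%:R * eps) / h + J%:R * eps)))
    + k%:R * (J%:R * eps).
Proof.
elim: k => [|k IH]; first by rewrite !big_geq//; ring.
by rewrite !big_nat_recr//= IH /step_error -natr1; ring.
Qed.

(** The chord is cut into k pieces and projected to the sphere; the second
    differences of the norm along the chord telescope to at most 4 / k. *)
Lemma orbit_sum_segment a b k : (0 < k)%N ->
  nrm a = rho -> nrm b = rho -> rho <= nrm (a + b) ->
  orbit_sum b <= orbit_sum a +
    (4 / rho * (J%:R * (4 / k%:R * Lam) + k%:R * (J%:R * (3 * eta * Lam) +
    6 * ((B + J%:R * eps) / h + J%:R * eps))) + k%:R * (J%:R * eps)).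
Proof.
move=> k0 ar br abr.
have kp : 0 < k%:R :> R by rewrite ltr0n.
pose ll i := a + (i%:R / k%:R) *: (b - a).
pose p i := (rho / nrm (ll i)) *: ll i.
have t0 i : 0 <= i%:R / k%:R :> R by rewrite divr_ge0.
have ll_ge i : rho / 4 <= nrm (ll i) by exact: chord_ge.
have ll_le i : (i <= k.+1)%N -> nrm (ll i) <= 3.
  move=> ik; apply: chord_le => //; rewrite t0 ler_pdivrMr//.
  rewrite (le_trans (_ : _ <= (k.+1)%:R))// ?ler_nat//.
  by rewrite -natrM ler_nat mul2n -addnn -addn1 leq_add2l.
have ll012 i : ll i + ll i.+2 = 2 *: ll i.+1.
  rewrite /ll addrACA -scalerDl [RHS]scalerDr scalerA scaler_nat mulr2n.
  congr (_ + _ *: _); rewrite -!natr1; field.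
  by rewrite gt_eqF.
have pa : p 0%N = a.
  by rewrite /p /ll mul0r scale0r addr0 ar divff ?gt_eqF// scale1r.
have pb : p k = b.
  by rewrite /p /ll divff ?gt_eqF// scale1r addrC subrK br divff ?gt_eqF// scale1r.
have : orbit_sum b - orbit_sum a <=
    \sum_(0 <= i < k) step_error (nrm (ll i) - 2 * nrm (ll i.+1) + nrm (ll i.+2)).
  rewrite -pa -pb -(telescope_sumr (fun i => orbit_sum (p i)))//.
  apply: ler_sum_nat => i /andP[_ ik].
  by apply: orbit_sum_step => //; exact: ll_le.
have sums : \sum_(0 <= i < k) (nrm (ll i) - 2 * nrm (ll i.+1) + nrm (ll i.+2)) <= 4 / k%:R.
  rewrite (eq_bigr (fun i => (nrm (ll i.+2) - nrm (ll i.+1)) - (nrm (ll i.+1) - nrm (ll i)))); last first.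
    by move=> i _; lra.
  rewrite (telescope_sumr (fun i => nrm (ll i.+1) - nrm (ll i)))//.
  have dl i : nrm (ll i.+1 - ll i) <= 2 / k%:R.
    have -> : ll i.+1 - ll i = k%:R^-1 *: (b - a).
      by rewrite /ll opprD addrACA subrr add0r -scalerBl -mulrBl -natr1 addrAC subrr add0r mul1r.
    rewrite nrmZp ?invr_ge0// mulrC ler_wpM2r ?invr_ge0//.
    by rewrite (le_trans (nrmB _ _))// ar br; have := rho_lt1; lra.
  have := nrm_le_dist (ll k.+1) (ll k); have := dl k.
  have := nrm_le_dist (ll 0%N) (ll 1%N); rewrite nrm_distC; have := dl 0%N.
  have -> : 4 / k%:R = 2 / k%:R + 2 / k%:R :> R by rewrite -mulrDl; congr (_ / _); lra.
  move: (2 / _) => u; lra.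
rewrite sum_step_error.
move: sums; set s := \sum_(_ <= _ < _) _ => sums.
have : 4 / rho * (J%:R * (s * Lam)) <= 4 / rho * (J%:R * (4 / k%:R * Lam)).
  rewrite ler_wpM2l ?divr_ge0 ?(ltW rho0)// ler_wpM2l// ler_wpM2r//.
  exact: slope_bound_ge0 r1_lt1.
rewrite !(mulrDr (4 / rho)); move: (4 / rho) => c; lra.
Qed.

(** By the second half of [slope], taken at n itself, slopes are almost
    nonnegative in the direction G n. *)
Lemma H_flow_mono i j p : nrm p <= rho -> (i + j <= J)%N ->
  H (fl i p) <= H (fl (j + i) p) + j%:R * ((1 + h) * eps).
Proof.
move=> pr; elim: j => [|j IH] ijJ; first by rewrite mul0r addr0.
rewrite addnS in ijJ; have jiJ : (j + i < J)%N by rewrite addnC.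
apply: (le_trans (IH (ltnW ijJ))); rewrite addSn -natr1 [X in _ <= _ + X]mulrDl mul1r.
rewrite [leRHS]addrA [leRHS]addrAC lerD2r; have [ep0 ep1] := andP eps01.
have lt1 := flow_lt1 (ltnW jiJ) pr; have lt1' := flow_lt1 jiJ pr.
have [l sl] := slopes lt1 ep0.
have := sl.1 _ lt1'.
rewrite {1}[fl (j + i).+1 p]/(_ + _) [X in l X]addrAC subrr add0r scalarZ.
have : h * - eps <= h * l (G (fl (j + i) p)).
  by rewrite ler_wpM2l ?(ltW h0)//; exact: slope_GE sl.
lra.
Qed.

Lemma orbit_sum_ge p : nrm p <= rho ->
  J%:R * H p <= orbit_sum p + J%:R * (J%:R * ((1 + h) * eps)).
Proof.
move=> pr; rewrite /orbit_sum; set c := J%:R * ((1 + h) * eps).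
have const_sum (x : R) : J%:R * x = \sum_(j < J) x.
  by rewrite sumr_const card_ord mulr_natl.
rewrite !const_sum -big_split/=; apply: ler_sum => j _.
have := H_flow_mono (i := 0) pr (ltnW (ltn_ord j)); rewrite addn0 => /le_trans; apply.
rewrite lerD2l ler_wpM2r ?ler_nat ?(ltnW (ltn_ord j))//.
have [ep0 ep1] := andP eps01.
by rewrite mulr_ge0 ?(ltW ep0)// addr_ge0 ?(ltW h0).
Qed.

Lemma orbit_sum_le p : nrm p <= rho ->
  orbit_sum p <= J%:R * (H (fl J p) + J%:R * ((1 + h) * eps)).
Proof.
move=> pr; rewrite /orbit_sum.
have const_sum (x : R) : J%:R * x = \sum_(j < J) x.
  by rewrite sumr_const card_ord mulr_natl.
rewrite [leRHS]const_sum; apply: ler_sum => j _.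
have := H_flow_mono (i := j) (j := J - j) pr.
rewrite subnKC ?subnK ?(ltnW (ltn_ord j))// => /(_ (leqnn _)) /le_trans; apply.
rewrite lerD2l ler_wpM2r ?ler_nat ?leq_subr//.
have [ep0 ep1] := andP eps01.
by rewrite mulr_ge0 ?(ltW ep0)// addr_ge0 ?(ltW h0).
Qed.

(** By monotonicity along the flow, H n1 is at most its orbit average, and the
    orbit average of p0, which is n2 flowed backwards for the whole time and
    normalized, is at most H n2. The two averages are compared along two chords
    through w or - w, where w has the direction of G n1: by skewness neither is
    nearly opposite to n1, and one of them is not nearly opposite to p0. *)
Lemma skew_compare_steps k n1 n2 : (0 < k)%N -> 0 < eta ->
  nrm n1 = rho -> nrm n2 = rho -> 0 < nrm (G n1) ->
  J%:R * H n1 <= J%:R * (H n2 + Lam * (2 * eta)) +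
    2 * (4 / rho * (J%:R * (4 / k%:R * Lam) + k%:R * (J%:R * (3 * eta * Lam) +
    6 * ((B + J%:R * eps) / h + J%:R * eps))) + k%:R * (J%:R * eps)) +
    2 * (J%:R * (J%:R * ((1 + h) * eps))).
Proof.
move=> k0 eta0 n1r n2r Gn1.
have rhop := rho0; have [_ eta1] := andP eta01.
pose m := flow (- h) J n2.
have m_ge : rho <= nrm m by rewrite -n2r /m; elim: J => //= j /le_trans; apply; exact: skewG.
have m_le : nrm m <= (1 + eta) * rho.
  have mh : forall j, nrm (flow (- h) j n2) <= growth (- h) j * nrm n2.
    by move=> j; exact: flow_le.
  by apply: (le_trans (mh _)); rewrite n2r growthN ler_wpM2r// ltW.
have m0 : 0 < nrm m by lra.
pose th := rho / nrm m.
have th0 : 0 <= th by rewrite divr_ge0 ?ltW.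
have th1 : th <= 1 by rewrite ler_pdivrMr ?mul1r.
have th_ge : 1 - eta <= th.
  rewrite ler_pdivlMr//.
  apply: (@le_trans _ _ ((1 - eta) * ((1 + eta) * rho))).
    by rewrite ler_wpM2l//; lra.
  have : 0 <= eta * eta * rho by rewrite !mulr_ge0 ?ltW.
  by lra.
pose p0 := th *: m.
have p0r : nrm p0 = rho by rewrite nrmZp// divfK// gt_eqF.
have end_p0 : nrm (fl J p0 - n2) <= 2 * eta.
  rewrite /p0 flowZ; set z := fl J m.
  have -> : th *: z - n2 = th *: (z - n2) - (1 - th) *: n2.
    by rewrite scalerBr scalerBl scale1r opprB addrA subrK.
  apply: (le_trans (nrmB _ _)); rewrite !nrmZp ?subr_ge0// n2r.
  have zn2 : nrm (z - n2) <= eta.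
    have [_ /le_trans] := flow_backK h J n2; apply; rewrite n2r.
    apply: (@le_trans _ _ (eta * rho)); last by rewrite ler_piMr ?ltW ?rho_lt1.
    by rewrite ler_wpM2r ?(ltW rho0)//; move: growthJ; lra.
  have i1 : th * nrm (z - n2) <= eta.
    by apply: le_trans zn2; rewrite ler_piMl ?nrm_ge0.
  have i2 : (1 - th) * rho <= eta.
    apply: (@le_trans _ _ (1 - th)); last by lra.
    by rewrite ler_piMr ?subr_ge0// ltW ?rho_lt1.
  lra.
have H_p0 : H (fl J p0) <= H n2 + Lam * (2 * eta).
  apply: (H_lipschitz r1_lt1) => //.
  - by apply: flow_le_r1; rewrite ?p0r.
  - rewrite n2r; apply: le_trans rho_r1; rewrite ler_peMl ?(ltW rho0)//; lra.
  - by rewrite mulr_gt0.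
pose w := (rho / nrm (G n1)) *: G n1.
have wr : nrm w = rho by rewrite nrmZp ?divr_ge0 ?nrm_ge0 ?(ltW rho0)// divfK// gt_eqF.
(* One of the signs of w works for p0, as |p0 + w| + |p0 - w| >= 2 rho; both
   work for n1, since G is skew. *)
have [b [br p0b bn1]] : exists b, [/\ nrm b = rho, rho <= nrm (p0 + b) & rho <= nrm (b + n1)].
  have [pw|pw] := lerP rho (nrm (p0 + w)).
    by exists w; split; rewrite // addrC -n1r; exact: skewG.
  exists (- w); split; first by rewrite nrmN.
    have : nrm (2 *: p0) <= nrm (p0 + w) + nrm (p0 - w).
      by rewrite scaler_nat mulr2n (le_trans _ (nrmD _ _))// addrACA subrr addr0.
    by rewrite nrmZp// p0r; lra.
  by rewrite addrC -n1r /w -scaleNr; exact: skewG.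
have s1 := orbit_sum_segment k0 p0r br p0b.
have s2 := orbit_sum_segment k0 br n1r bn1.
have n1r' : nrm n1 <= rho by rewrite n1r.
have p0r' : nrm p0 <= rho by rewrite p0r.
have := orbit_sum_ge n1r'; have := orbit_sum_le p0r'.
have : J%:R * H (fl J p0) <= J%:R * (H n2 + Lam * (2 * eta)) by rewrite ler_wpM2l.
rewrite mulrDr; move: s1 s2; move: (4 / rho * _ + _) => u; lra.
Qed.

End segment.

(** With a fixed total time, the growth of the flow tends to 1 as the step
    tends to 0, by Bernoulli's inequality. *)
Lemma growth_small (c e : R) : 0 <= c -> 0 < e ->
  exists2 J : nat, (0 < J)%N & (1 + c / J%:R ^+ 2) ^+ J <= 1 + e.
Proof.
move=> c0 e0.
have bern (y : R) n : 0 <= y -> (1 + y) ^+ n * (1 - n%:R * y) <= 1.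
  move=> y0; elim: n => [|n IH]; first by rewrite expr0 mul0r subr0 mulr1.
  apply: le_trans IH; rewrite exprSr -mulrA ler_wpM2l ?exprn_ge0 ?addr_ge0//.
  have : 0 <= n.+1%:R * (y * y) :> R by rewrite !mulr_ge0.
  by rewrite -natr1; lra.
have q0 : 0 <= c * (1 + e) / e.
  by apply: divr_ge0; [apply: mulr_ge0|]; lra.
have := archi_boundP q0; set J := Num.bound _ => cJ.
have J0 : 0 < J%:R :> R by exact: le_lt_trans cJ.
exists J; first by rewrite -(ltr0n R).
have := bern (c / J%:R ^+ 2) J; rewrite divr_ge0 ?sqr_ge0// => /(_ isT).
have -> : J%:R * (c / J%:R ^+ 2) = c / J%:R by field; rewrite gt_eqF.
have q1 : (1 + e)^-1 <= 1 - c / J%:R.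
  have e1 : 0 < 1 + e by lra.
  have u : c / J%:R * (1 + e) <= e.
    by rewrite mulrAC ler_pdivrMr// [e * _]mulrC -ler_pdivrMr// ltW.
  by rewrite -div1r ler_pdivrMr//; lra.
have x0 : 0 <= (1 + c / J%:R ^+ 2) ^+ J.
  by rewrite exprn_ge0// addr_ge0// divr_ge0 ?sqr_ge0.
move=> le1; have := le_trans (ler_wpM2l x0 q1) le1.
by rewrite ler_pdivrMr ?mul1r//; lra.
Qed.

(** For smooth nrm and H and for G = 0, [slope] says that the gradients of H are
    normal to spheres, so that H is constant on spheres. For general G they are
    only normal to spheres at points where H is stationary along the flow of G,
    which is so on average as H is bounded. *)
Lemma skew_le n1 n2 : nrm n1 = nrm n2 -> nrm n1 < 1 -> 0 < nrm (G n1) ->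
  H n1 <= H n2.
Proof.
set rho := nrm n1 => n2r r_lt1 Gn1.
have rho0 : 0 < rho.
  rewrite lt_neqAle nrm_ge0 andbT; apply/eqP => r0.
  by have := nrmG n1; rewrite -/rho -r0 mulr0; lra.
pose r1 := (1 + rho) / 2.
have r1_lt1 : r1 < 1 by rewrite /r1; lra.
pose Lam := slope_bound r1.
have L0 : 0 <= Lam := slope_bound_ge0 r1_lt1.
pose K := 2 * Lam + 8 / rho * (7 * Lam + 6 * B).
have K0 : 0 <= K.
  have b := B0.
  have r8 : 0 <= 8 / rho by rewrite divr_ge0 ?(ltW rho0).
  have LB : 0 <= 7 * Lam + 6 * B by lra.
  by have := mulr_ge0 r8 LB; rewrite /K; lra.
suff main k : (0 < k)%N -> H n1 <= H n2 + K / k%:R.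
  apply/ler_addgt0Pr => e e0.
  have q0 : 0 <= K / e by rewrite divr_ge0 ?(ltW e0).
  have := archi_boundP q0; set k := Num.bound _ => kq.
  have k0 : 0 < k%:R :> R by exact: le_lt_trans kq.
  apply: (le_trans (main k _)); first by rewrite -(ltr0n R).
  by rewrite lerD2l ler_pdivrMr// [e * _]mulrC -ler_pdivrMr// ltW.
move=> k0; have kp : 0 < k%:R :> R by rewrite ltr0n.
have k1 : 1 <= k%:R :> R by rewrite ler1n.
have k2_ge1 : 1 <= k%:R ^+ 2 :> R by rewrite exprn_ege1.
(* k points per segment, total time J h = k^2, drift eta = O(k^-2): then the
   bound B on the oscillation of H costs k B / k^2, the drift k eta and the
   second differences of the norm 4 / k. *)
pose eta := (1 - rho) / 2 / k%:R ^+ 2.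
have eta0 : 0 < eta by rewrite !divr_gt0 ?exprn_gt0//; lra.
have eta_le : eta <= (1 - rho) / 2.
  by rewrite ler_pdivrMr ?exprn_gt0// ler_peMr//; lra.
have etak : eta <= 1 / k%:R ^+ 2.
  by rewrite ler_wpM2r ?invr_ge0 ?sqr_ge0//; lra.
have [J J0 Jd] := growth_small (mulr_ge0 (sqr_ge0 (k%:R ^+ 2 : R)) (sqr_ge0 g)) eta0.
have Jp : 0 < J%:R :> R by rewrite ltr0n.
pose h := k%:R ^+ 2 / J%:R : R.
have h0 : 0 < h by rewrite divr_gt0 ?exprn_gt0.
have dJ : growth h J <= 1 + eta.
  by apply: le_trans Jd; rewrite /growth /h expr_div_n mulrAC.
have rr1 : (1 + eta) * rho <= r1.
  have : eta * rho <= eta by rewrite ler_piMr// ltW.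
  by rewrite /r1; lra.
have eta01 : 0 <= eta <= 1 by apply/andP; split; lra.
(* c collects the coefficients of the slope error eps, the last parameter to be
   chosen; the remaining errors are O(1/k). *)
pose c := 2 * (4 / rho * (k%:R * (6 * (h^-1 + 1))) + k%:R) + 2 * (J%:R * (1 + h)).
have c0 : 0 <= c.
  rewrite /c !(addr_ge0, mulr_ge0, divr_ge0, invr_ge0)//; exact: ltW.
have step eps : 0 < eps -> eps <= 1 -> H n1 <= H n2 + Lam * (2 * eta) +
    2 * (4 / rho * (4 / k%:R * Lam + k%:R * (3 * eta * Lam + 6 * (B / k%:R ^+ 2)))) + c * eps.
  move=> e0 e1; have e01 : 0 < eps <= 1 by rewrite e0.
  rewrite -(ler_pM2l Jp).
  apply: (le_trans (skew_compare_steps h0 rho0 r1_lt1 eta01 e01 dJ rr1 k0 eta0 erefl (esym n2r) Gn1)).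
  rewrite le_eqVlt; apply/orP; left; apply/eqP.
  rewrite /c /h -/Lam; field.
  by rewrite !gt_eqF.
have : H n1 <= H n2 + Lam * (2 * eta) +
    2 * (4 / rho * (4 / k%:R * Lam + k%:R * (3 * eta * Lam + 6 * (B / k%:R ^+ 2)))).
  apply/ler_addgt0Pr => d d0.
  pose eps := Num.min 1 (d / (c + 1)).
  have c1 : 0 < c + 1 by lra.
  have e0 : 0 < eps by rewrite lt_min ltr01 divr_gt0.
  have e1 : eps <= 1 by rewrite ge_min lexx.
  apply: (le_trans (step _ e0 e1)); rewrite lerD2l.
  apply: (@le_trans _ _ ((c + 1) * eps)); first by rewrite ler_wpM2r ?(ltW e0)//; lra.
  by rewrite mulrC -ler_pdivlMr// ge_min lexx orbT.
move=> /le_trans; apply; rewrite -addrA lerD2l.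
have kk : 1 / k%:R ^+ 2 <= k%:R^-1 :> R.
  by rewrite div1r lef_pV2 ?posrE ?exprn_gt0// expr2 ler_peMr// ltW.
have i1 : Lam * (2 * eta) <= 2 * Lam / k%:R.
  rewrite mulrCA -mulrA ler_wpM2l// ler_wpM2l//; exact: le_trans kk.
have i2 : k%:R * (3 * eta * Lam) <= 3 * Lam / k%:R.
  have : k%:R * eta <= k%:R^-1.
    rewrite -[leRHS]mul1r ler_pdivlMr// mulrAC -expr2 -ler_pdivlMl ?exprn_gt0//.
    by rewrite mulr1 -div1r.
  by move=> /(ler_wpM2l L0) le; have := le; lra.
have i3 : k%:R * (6 * (B / k%:R ^+ 2)) = 6 * B / k%:R.
  by field; rewrite gt_eqF.
rewrite /K (mulrDr k%:R) i3 [leRHS]mulrDl; apply: lerD => //.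
have -> : 2 * (4 / rho * (4 / k%:R * Lam + (k%:R * (3 * eta * Lam) + 6 * B / k%:R))) =
  8 / rho * (4 / k%:R * Lam + (k%:R * (3 * eta * Lam) + 6 * B / k%:R)).
  by rewrite mulrA; congr (_ * _); rewrite mulrA; congr (_ / _); lra.
rewrite -[leRHS]mulrA ler_wpM2l ?divr_ge0 ?(ltW rho0)//.
by move: i2; move: (k%:R * (3 * eta * Lam)) (k%:R^-1) => u v; lra.
Qed.

End skew_flow.

(** * Real parts, real norms and functionals *)

Section evaluation.
Context {K : numFieldType} {V W : normedModType K}.
Implicit Types (S T : bounded_op V W).

Lemma bounded_opDE S T x : (S + T) x = S x + T x. Proof. by []. Qed.
Lemma bounded_opBE S T x : (S - T) x = S x - T x. Proof. by []. Qed.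
Lemma bounded_opZE a S x : (a *: S) x = a *: S x. Proof. by []. Qed.

End evaluation.

Section scalars.
Context {R : realType} {k : scalar_kind}.
Local Notation K := (scalar_field R k).
Implicit Types (a b c : K) (t : R).

Lemma realpartD a b : realpart (a + b) = realpart a + realpart b.
Proof. by case: k a b => //= -[a1 a2] [b1 b2]. Qed.

Lemma realpartN a : realpart (- a) = - realpart a.
Proof. by case: k a => //= -[a1 a2]. Qed.

Lemma realpartB a b : realpart (a - b) = realpart a - realpart b.
Proof. by rewrite realpartD realpartN. Qed.

Lemma realpart_ofrealM t a : realpart (ofreal k t * a) = t * realpart a.
Proof. by case: k a => //= -[a1 a2] /=; rewrite mul0r subr0. Qed.

Lemma realpart_ofrealZ t (a : K^o) : realpart (ofreal k t *: a) = t * realpart a.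
Proof. exact: realpart_ofrealM. Qed.

Lemma ofreal1 : ofreal k 1 = 1 :> K.
Proof. by case: k. Qed.

Lemma ofrealN t : ofreal k (- t) = - ofreal k t :> K.
Proof. by case: k => //=; exact: (raddfN (real_complex R)). Qed.

Lemma realpart0 : realpart (0 : K) = 0.
Proof. by case: k. Qed.

Lemma realpart1 : realpart (1 : K) = 1.
Proof. by case: k. Qed.

Lemma rnorm1 : rnorm (1 : K^o) = 1.
Proof. by rewrite -ofreal1 rnorm_ofreal. Qed.

Lemma rnorm_ofrealE t : rnorm (ofreal k t : K^o) = `|t|.
Proof.
have [t0|t0] := ger0P t; first exact: rnorm_ofreal.
have nt0 : 0 <= - t by lra.
by rewrite -[in LHS](opprK t) ofrealN /rnorm normrN -[RHS](rnorm_ofreal (k := k) nt0).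
Qed.

Lemma normr_realpart_le a : `|realpart a| <= rnorm (a : K^o).
Proof.
rewrite /rnorm; case: k a => //= -[a1 a2] /=.
by rewrite -sqrtr_sqr ler_wsqrtr// lerDl sqr_ge0.
Qed.

Lemma realpart_le a : realpart a <= rnorm (a : K^o).
Proof. exact: le_trans (ler_norm _) (normr_realpart_le a). Qed.

Lemma phase a : exists2 c : K, rnorm (c : K^o) = 1 & c * a = ofreal k (rnorm (a : K^o)).
Proof.
have [->|a0] := eqVneq a 0.
  by exists 1; [exact: rnorm1|rewrite mulr0 rnorm0 ofreal0].
exists (`|a| / a); last by rewrite divfK// ofreal_rnorm.
apply: (@ofreal_inj R k); rewrite ofreal_rnorm ofreal1 normrM normfV normr_id.
by rewrite divff// normr_eq0.
Qed.

(** The imaginary unit, read as zero for real scalars, so that both cases of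
    the recovery of a functional from its real part are covered at once. *)
Definition imag_unit : K :=
  match k return scalar_field R k with
  | RealScalars => 0
  | ComplexScalars => Complex 0 1
  end.

Lemma rnorm_le_parts a :
  rnorm (a : K^o) <= `|realpart a| + `|realpart (imag_unit * a)|.
Proof.
rewrite /rnorm /imag_unit; case: k a => /= [a|[a1 a2]].
  by rewrite lerDl.
rewrite /= mul0r mul1r sub0r normrN.
have -> : `|a1| + `|a2| = Num.sqrt ((`|a1| + `|a2|) ^+ 2).
  by rewrite sqrtr_sqr [RHS]ger0_norm ?addr_ge0.
rewrite ler_wsqrtr// sqrrD !real_normK ?num_real// lerD2r lerDl.
by rewrite mulrn_wge0// mulr_ge0.
Qed.

End scalars.

Section real_norm.
Context {R : realType} {k : scalar_kind} {V : normedModType (scalar_field R k)}.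
Implicit Types x y : V.

Lemma rnormN x : rnorm (- x) = rnorm x.
Proof. by rewrite /rnorm normrN. Qed.

Lemma ler_rnormB x y : rnorm (x - y) <= rnorm x + rnorm y.
Proof. by rewrite -(rnormN y) ler_rnormD. Qed.

Lemma rnorm_distC x y : rnorm (x - y) = rnorm (y - x).
Proof. by rewrite -rnormN opprB. Qed.

Lemma rnorm_le_dist x y : rnorm x <= rnorm y + rnorm (x - y).
Proof. by have := ler_rnormD y (x - y); rewrite addrC subrK. Qed.

Lemma rnormZr (t : R) x : rnorm (ofreal k t *: x) = `|t| * rnorm x.
Proof. by rewrite rnormZ rnorm_ofrealE. Qed.

End real_norm.

Section functional_from_real_part.
Context {R : realType} {k : scalar_kind} {V : normedModType (scalar_field R k)}.
Local Notation K := (scalar_field R k).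

(** Over the complex numbers f(x) = r(x) - i r(ix); the norm bound holds because
    f(x) is real and nonnegative after multiplication of x by a phase. *)
Lemma functional_of_real_part (r : V -> R) (M : R) : 0 <= M ->
  (forall x y, r (x + y) = r x + r y) ->
  (forall t x, r (ofreal k t *: x) = t * r x) ->
  (forall x, r x <= M * rnorm x) ->
  exists2 f : dual V, forall x, realpart (f x) = r x & rnorm f <= M.
Proof.
move=> M0 rD rZ rM.
have [F [Flin Fr]] : exists F : V -> K^o, linear F /\ forall x, realpart (F x) = r x.
  move: V r rD rZ {rM M0}; rewrite /scalar_field; case: k => W r rD rZ.
    by exists r; split => // a x y; rewrite rD rZ.
  pose I : R[i] := Complex 0 1.
  exists (fun x => Complex (r x) (- r (I *: x))); split => // -[a b] x y.
  have scE (z : W) : Complex a b *: z = Complex a 0 *: z + Complex b 0 *: (I *: z).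
    rewrite scalerA -scalerDl; congr (_ *: _).
    by rewrite /I; apply/eqP; rewrite eq_complex /= !(mulr0, mul0r, mulr1, subr0, addr0, add0r) !eqxx.
  have rI (z : W) : r (I *: (I *: z)) = - r z.
    rewrite scalerA (_ : I * I = Complex (-1) 0) ?rZ ?mulN1r//.
    by rewrite /I; apply/eqP; rewrite eq_complex /= !(mulr0, mul0r, mulr1, subr0, addr0, add0r, sub0r) !eqxx.
  have rIc : r (I *: (Complex a b *: x + y)) = a * r (I *: x) - b * r x + r (I *: y).
    rewrite scalerDr rD; congr (_ + _).
    rewrite scE scalerDr rD !scalerA (mulrC I (Complex a 0)) -!scalerA rZ; congr (_ + _).
    by rewrite scalerA (mulrC I) -scalerA rZ rI mulrN.
  rewrite rIc rD scE rD !rZ.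
  apply/eqP; rewrite eq_complex /=; apply/andP; split; apply/eqP; ring.
have FM x : rnorm (F x) <= M * rnorm x.
  have [c c1 cF] := phase (F x).
  have F0 : F 0 = 0.
    by have := Flin (-1) 0 0; rewrite scaler0 addr0 scaleN1r addNr.
  have FZ : F (c *: x) = c * F x by have := Flin c x 0; rewrite !addr0 F0 addr0.
  have : realpart (F (c *: x)) = rnorm (F x) by rewrite FZ cF ofrealK.
  by rewrite Fr => <-; rewrite (le_trans (rM _))// rnormZ c1 mul1r.
have Fb : F \in bounded_linear V K^o.
  apply/asboolP; split => //; exists (ofreal k M) => x.
  by rewrite -!ofreal_rnorm -ofrealM ler_ofreal.
exists (BoundedOp Fb) => //.
by rewrite rnorm_opE; exact: opnorm_le.
Qed.

End functional_from_real_part.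

(** * The Hahn-Banach theorem *)

Section hahn_banach.
Context {R : realType} {E : lmodType R}.
Implicit Types (p q : E -> R) (D : E -> R -> Prop) (x y : E).

Definition sublinear p : Prop :=
  (forall x y, p (x + y) <= p x + p y) /\ (forall t x, 0 <= t -> p (t *: x) <= t * p x).

Definition minorant_cone q D : Prop :=
  [/\ D 0 0, forall x y r s, D x r -> D y s -> D (x + y) (r + s),
      forall t x r, 0 < t -> D x r -> D (t *: x) (t * r) &
      forall x r, D x r -> r <= q x].

Lemma sublinear0 p : sublinear p -> p 0 = 0.
Proof.
move=> [pD pZ]; apply/eqP; rewrite eq_le; apply/andP; split.
  by have := pZ 0 0 (lexx 0); rewrite scale0r mul0r.
by have := pD 0 0; rewrite addr0; lra.
Qed.

Lemma sublinear_opp p x : sublinear p -> - p (- x) <= p x.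
Proof. by move=> sp; have := sp.1 x (- x); rewrite subrr sublinear0//; lra. Qed.

(** The infimal convolution of q with the cone: the largest sublinear function
    below q whose linear minorants dominate the prescribed values on D. *)
Definition cone_inf q D x := inf [set q (x + e.1) - e.2 | e in [set e | D e.1 e.2]].

Lemma cone_inf_lb q D x e r : sublinear q -> minorant_cone q D -> D e r ->
  - q (- x) <= q (x + e) - r.
Proof.
move=> sq [_ _ _ Dq] /Dq; have := sq.1 (- x) (x + e); rewrite addKr; lra.
Qed.

Lemma cone_inf_le q D x e r : sublinear q -> minorant_cone q D -> D e r ->
  cone_inf q D x <= q (x + e) - r.
Proof.
move=> sq mD De; apply: ge_inf; last by exists (e, r).
exists (- q (- x)) => _ [[f s]/= Df <-]; exact: cone_inf_lb sq mD Df.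
Qed.

Lemma cone_inf_ge q D x c : minorant_cone q D ->
  (forall e r, D e r -> c <= q (x + e) - r) -> c <= cone_inf q D x.
Proof.
move=> [D0 _ _ _] cD; apply: lb_le_inf; first by exists (q (x + 0) - 0), (0, 0).
by move=> _ [[e r]/= De <-]; exact: cD.
Qed.

Lemma cone_inf_sublinear q D : sublinear q -> minorant_cone q D ->
  sublinear (cone_inf q D).
Proof.
move=> sq mD; have [D0 DD DZ Dq] := mD; split=> [x y|t x].
  rewrite -lerBlDr; apply: cone_inf_ge => // e r De.
  rewrite lerBlDr -lerBlDl; apply: cone_inf_ge => // f s Df.
  have := cone_inf_le (x + y) sq mD (DD _ _ _ _ De Df).
  by rewrite addrACA; have := sq.1 (x + e) (y + f); lra.
rewrite le_eqVlt => /predU1P[<-|t0].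
  rewrite scale0r mul0r (le_trans (cone_inf_le _ sq mD D0))//.
  by rewrite addr0 subr0 sublinear0.
rewrite mulrC -ler_pdivrMr//; apply: cone_inf_ge => // e r De.
rewrite ler_pdivrMr// mulrC.
apply: (le_trans (cone_inf_le _ sq mD (DZ _ _ _ t0 De))).
by rewrite -scalerDr mulrBr lerD2r; exact: sq.2 _ _ (ltW t0).
Qed.

(** Along a chain of sublinear functions the pointwise infimum is again
    sublinear, so Zorn's lemma applies. *)
Lemma minimal_sublinear q : sublinear q -> exists p,
  [/\ sublinear p, forall x, p x <= q x &
      forall p', sublinear p' -> (forall x, p' x <= p x) -> p' = p].
Proof.
move=> sq.
pose T := {p : E -> R | sublinear p /\ forall x, p x <= q x}.
pose below (a b : T) := `[< forall x, sval b x <= sval a x >].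
have [||||[p [sp pq]] pmin] := @Zorn T below.
- by move=> a; apply/asboolP.
- move=> a b c /asboolP ab /asboolP bc; apply/asboolP => x.
  exact: le_trans (ab x).
- move=> [a ha] [b hb] /asboolP/= ab /asboolP/= ba.
  apply: eq_exist; apply/funext => x; apply/eqP; rewrite eq_le.
  by rewrite ab ba.
- move=> A Atot; have [->|/set0P [a0 Aa0]] := eqVneq A set0.
    by exists (exist _ q (conj sq (fun x => lexx _))).
  pose S x := [set sval a x | a in A].
  have Slb x : lbound (S x) (- q (- x)).
    move=> _ [[a [sa aq]] _ <-] /=.
    by have := sublinear_opp x sa; have := aq (- x); lra.
  have infle a x : A a -> inf (S x) <= sval a x.
    by move=> Aa; apply: ge_inf; [exists (- q (- x))|exists a].
  have infge c x : (forall a, A a -> c <= sval a x) -> c <= inf (S x).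
    by move=> ca; apply: lb_le_inf; [exists (sval a0 x), a0|move=> _ [a Aa <-]; exact: ca].
  pose m x := inf (S x).
  have sm : sublinear m.
    split=> [x y|t x].
      rewrite -lerBlDr; apply: (infge) => a Aa.
      rewrite lerBlDr -lerBlDl; apply: (infge) => b Ab.
      have [/asboolP ab|/asboolP ba] := Atot _ _ Aa Ab.
        have := (svalP b).1.1 x y; have := infle _ (x + y) Ab; have := ab x.
        rewrite /m; lra.
      have := (svalP a).1.1 x y; have := infle _ (x + y) Aa; have := ba y.
      rewrite /m; lra.
    rewrite le_eqVlt => /predU1P[<-|t0].
      rewrite scale0r mul0r (le_trans (infle _ _ Aa0))//.
      by rewrite sublinear0//; exact: (svalP a0).1.
    rewrite mulrC -ler_pdivrMr//; apply: (infge) => a Aa.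
    rewrite ler_pdivrMr// mulrC (le_trans (infle _ _ Aa))//.
    exact: (svalP a).1.2 _ _ (ltW t0).
  have mq x : m x <= q x by apply: le_trans (infle _ _ Aa0) _; exact: (svalP a0).2.
  by exists (exist _ m (conj sm mq)) => a Aa; apply/asboolP => x; exact: infle.
exists p; split => // p' sp' p'p.
have p'q x : p' x <= q x by exact: le_trans (p'p x) (pq x).
have ple : below (exist _ p (conj sp pq)) (exist _ p' (conj sp' p'q)) by exact/asboolP.
by have /(congr1 sval) := pmin _ ple.
Qed.

(** Mazur-Orlicz form of the Hahn-Banach theorem. A minimal sublinear function
    below the infimal convolution of q with the cone is linear: minimality
    forbids lowering it in any direction. *)
Lemma hahn_banach q D : sublinear q -> minorant_cone q D ->
  exists L : {scalar E}, (forall x, L x <= q x) /\ (forall e r, D e r -> r <= L e).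
Proof.
move=> sq mD; have sqD := cone_inf_sublinear sq mD.
have [p [sp pq pmin]] := minimal_sublinear sqD.
have supadd x y : p y + p x <= p (y + x).
  pose C e r := exists2 t, 0 <= t & e = t *: x /\ r = t * p x.
  have C1 : C x (p x) by exists 1; rewrite ?scale1r ?mul1r.
  have mC : minorant_cone p C.
    split.
    - by exists 0; rewrite ?scale0r ?mul0r.
    - move=> _ _ _ _ [t t0 [-> ->]] [s s0 [-> ->]].
      by exists (t + s); rewrite ?addr_ge0 ?scalerDl ?mulrDl.
    - move=> s _ _ s0 [t t0 [-> ->]]; exists (s * t); last by rewrite scalerA mulrA.
      by rewrite mulr_ge0// ltW.
    - move=> _ _ [t t0 [-> ->]]; have := sublinear_opp (t *: x) sp.
      have [->|tn0] := eqVneq t 0; first by rewrite scale0r mul0r sublinear0.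
      have tp : 0 < t by rewrite lt_neqAle eq_sym tn0.
      have := sp.2 t^-1 (t *: x); rewrite scalerA mulVf// scale1r invr_ge0 => /(_ t0).
      by rewrite ler_pdivlMl.
  have sC := cone_inf_sublinear sp mC.
  have Cp z : cone_inf p C z <= p z.
    have C0 : C 0 0 by case: mC.
    by rewrite (le_trans (cone_inf_le z sp mC C0))// addr0 subr0.
  have pE : cone_inf p C = p := pmin _ sC Cp.
  by have := cone_inf_le y sp mC C1; rewrite pE; lra.
have pD x y : p (x + y) = p x + p y.
  by apply/eqP; rewrite eq_le sp.1 supadd.
have pN x : p (- x) = - p x.
  by have := pD x (- x); rewrite subrr sublinear0//; lra.
have pZ t x : p (t *: x) = t * p x.
  have pZ0 s y : 0 <= s -> p (s *: y) = s * p y.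
    move=> s0; apply/eqP; rewrite eq_le sp.2//=.
    by have := sp.2 s (- y) s0; rewrite scalerN !pN; lra.
  have [t0|t0] := leP 0 t; first exact: pZ0.
  by rewrite -[t]opprK scaleNr pN pZ0 ?mulNr// oppr_ge0 ltW.
have plin : scalar p by move=> t x y; rewrite pD pZ.
pose L : {scalar E} := HB.pack p (GRing.isLinear.Build R E R *%R p plin).
have D0 : D 0 0 by case: mD.
exists L; split => [x|e r De].
  by rewrite (le_trans (pq x))// (le_trans (cone_inf_le x sq mD D0))// addr0 subr0.
have := pq (- e); have := cone_inf_le (- e) sq mD De.
by rewrite addNr sublinear0// pN /=; lra.
Qed.

End hahn_banach.

(** * Normed spaces as real vector spaces *)

(** Restriction of scalars, as an alias of V, so that the real Hahn-Banach
    theorem and the real flow of the skew operator apply in both cases. *)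
Definition realify (R : realType) (k : scalar_kind)
  (V : lmodType (scalar_field R k)) : Type := V.

Section realify.
Context {R : realType} {k : scalar_kind} {V : lmodType (scalar_field R k)}.

HB.instance Definition _ := GRing.Zmodule.copy (realify V) V.

Let scale (t : R) (x : realify V) : realify V := ofreal k t *: (x : V).

Let scaleA a b v : scale a (scale b v) = scale (a * b) v.
Proof. by rewrite /scale scalerA ofrealM. Qed.

Let scale1 : left_id 1 scale.
Proof. by move=> v; rewrite /scale ofreal1 scale1r. Qed.

Let scaleDr : right_distributive scale +%R.
Proof. by move=> a u v; rewrite /scale scalerDr. Qed.

Let scaleDl v : {morph scale^~ v : a b / a + b}.
Proof. by move=> a b; rewrite /scale ofrealD scalerDl. Qed.

HB.instance Definition _ := GRing.Zmodule_isLmodule.Build R (realify V)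
  scaleA scale1 scaleDr scaleDl.

Lemma realify_scaleE (t : R) (x : realify V) :
  t *: x = (ofreal k t *: (x : V)) :> V.
Proof. by []. Qed.

End realify.


Section real_linear.
Context {R : realType} {k : scalar_kind} {V : normedModType (scalar_field R k)}.

Lemma realify_linear (f : V -> V) :
  (forall a x y, f (a *: x + y) = a *: f x + f y) ->
  exists L : {linear realify V -> realify V}, forall x : V, L x = f x.
Proof.
move=> fl.
have lL : linear (f : realify V -> realify V) by move=> t x y; exact: fl.
pose linL := GRing.isLinear.Build R (realify V) (realify V) *:%R f lL.
pose L : {linear realify V -> realify V} := HB.pack (f : realify V -> realify V) linL.
by exists L.
Qed.

Lemma realpart_scalar (y : V) :
  exists L : {scalar realify (dual V)}, forall n : dual V, L n = realpart (n y).
Proof.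
pose l (n : realify (dual V)) : R := realpart ((n : dual V) y).
have ll : scalar l.
  move=> t n n'; rewrite /l.
  have -> : ((t *: n + n') : realify (dual V)) = ofreal k t *: (n : dual V) + (n' : dual V) by [].
  by rewrite bounded_opDE bounded_opZE realpartD realpart_ofrealZ.
pose linL := GRing.isLinear.Build R (realify (dual V)) R *%R l ll.
pose L : {scalar realify (dual V)} := HB.pack l linL.
by exists L.
Qed.

End real_linear.

(** * Numerical radius, numerical index and operators of rank one *)

Section norming.
Context {R : realType} {k : scalar_kind}.
Local Notation K := (scalar_field R k).
Implicit Type X : normedModType K.

Lemma realpart_maximal (a : K) : rnorm (a : K^o) <= realpart a ->
  a = ofreal k (rnorm (a : K^o)).
Proof.
have : realpart a <= rnorm (a : K^o) := realpart_le a.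
rewrite /rnorm; case: k a => /= [a|[a1 a2] /=] le1 le2.
  by apply/eqP; rewrite eq_le le1 le2.
have a10 : 0 <= a1 by apply: le_trans le2; rewrite sqrtr_ge0.
have eq1 : a1 = Num.sqrt (a1 ^+ 2 + a2 ^+ 2) by apply/eqP; rewrite eq_le le1 le2.
have : a1 ^+ 2 = a1 ^+ 2 + a2 ^+ 2.
  by rewrite {1}eq1 sqr_sqrtr// addr_ge0 ?sqr_ge0.
move/eqP; rewrite -subr_eq0 opprD addrA subrr sub0r oppr_eq0 sqrf_eq0 => /eqP a20.
by rewrite -eq1 a20.
Qed.

Lemma functional_le X (f : dual X) x : rnorm (f x) <= rnorm f * rnorm x.
Proof. by rewrite rnorm_opE; exact: rnorm_le_opnorm. Qed.

Lemma realpart_functional_le X (f : dual X) x : realpart (f x) <= rnorm f * rnorm x.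
Proof. exact: le_trans (realpart_le _) (functional_le f x). Qed.

Lemma functional_norm_le X (f : dual X) (M : R) : 0 <= M ->
  (forall x, realpart (f x) <= M * rnorm x) -> rnorm f <= M.
Proof.
move=> M0 fM; rewrite rnorm_opE; apply: opnorm_le => // x.
have [c c1 cf] := phase (f x).
have := fM (c *: x); rewrite linearZ /= -[_ *: _]/(c * f x) cf ofrealK rnormZ c1.
by rewrite mul1r.
Qed.

Lemma norming_functional X (x : X) :
  exists2 f : dual X, rnorm f <= 1 & f x = ofreal k (rnorm x).
Proof.
pose q (y : realify X) : R := rnorm (y : X).
have sq : sublinear q.
  split=> [y z|t y t0]; first exact: ler_rnormD.
  by rewrite /q realify_scaleE rnormZr ger0_norm.
pose D (e : realify X) (r : R) := exists2 t : R, 0 <= t &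
  e = t *: (x : realify X) /\ r = t * rnorm x.
have mD : minorant_cone q D.
  split.
  - by exists 0 => //; rewrite scale0r mul0r.
  - move=> _ _ _ _ [t t0 [-> ->]] [s s0 [-> ->]].
    by exists (t + s); rewrite ?addr_ge0 ?scalerDl ?mulrDl.
  - move=> s _ _ s0 [t t0 [-> ->]]; exists (s * t); last by rewrite scalerA mulrA.
    by rewrite mulr_ge0// ltW.
  - by move=> _ _ [t t0 [-> ->]]; rewrite /q realify_scaleE rnormZr ger0_norm.
have [L [Lq LD]] := hahn_banach sq mD.
have [f fL f1] : exists2 f : dual X, forall y, realpart (f y) = L (y : realify X) & rnorm f <= 1.
  apply: functional_of_real_part => // [y z|t y|y].
  - exact: linearD.
  - exact: (linearZ_LR L).
  - by rewrite mul1r; exact: Lq.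
exists f => //.
have fx : rnorm x <= realpart (f x).
  by rewrite fL; apply: LD; exists 1; rewrite ?scale1r ?mul1r.
have fx' : rnorm (f x) <= rnorm x.
  by apply: (le_trans (functional_le f x)); rewrite ler_piMl ?rnorm_ge0.
rewrite (realpart_maximal (le_trans fx' fx)); congr (ofreal _ _).
apply/eqP; rewrite eq_le fx' /=; exact: le_trans fx (realpart_le _).
Qed.

Lemma norming_functional_unit X (x : X) : x != 0 ->
  exists2 f : dual X, rnorm f = 1 & f x = ofreal k (rnorm x).
Proof.
move=> x0; have [f f1 fx] := norming_functional x; exists f => //.
have nx : 0 < rnorm x.
  by rewrite lt_def rnorm_ge0 andbT; apply: contra_neq x0 => /rnorm_eq0.
apply/eqP; rewrite eq_le f1 /= -(ler_pM2r nx) mul1r.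
by have := realpart_functional_le f x; rewrite fx ofrealK.
Qed.

End norming.

Section numerical_radius_theory.
Context {R : realType} {k : scalar_kind} {X : normedModType (scalar_field R k)}.
Local Notation K := (scalar_field R k).
Implicit Types (S T : bounded_op X X) (x : X) (y f : dual X).

Lemma numerical_radius_le_opnorm T : numerical_radius T <= opnorm T.
Proof.
apply: sup_image_le => [|p Pp]; first exact: opnorm_ge0.
exact: numerical_radius_ub.
Qed.

Lemma numerical_radius_norming T f x : x != 0 -> rnorm f = 1 ->
  f x = ofreal k (rnorm x) -> realpart (f (T x)) <= numerical_radius T * rnorm x.
Proof.
move=> x0 f1 fx.
have nx : 0 < rnorm x.
  by rewrite lt_def rnorm_ge0 andbT; apply: contra_neq x0 => /rnorm_eq0.
pose u := ofreal k (rnorm x)^-1 *: x.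
have pu : state_pairs X (f, u).
  split=> //=; first by rewrite rnormZr ger0_norm ?invr_ge0 ?(ltW nx)// mulVf ?gt_eqF.
  by rewrite linearZ /= fx -[_ *: _]/(_ * _) -ofrealM mulVf ?gt_eqF// ofreal1.
have := le_numerical_radius T pu; rewrite /= linearZ linearZ /=.
move=> /(le_trans (realpart_le _)); rewrite realpart_ofrealZ.
by rewrite ler_pdivrMl// mulrC.
Qed.

(** Lumer's estimate. Evaluation at a norming functional of z shows that
    1 - tT shrinks z at most by the factor 1 - t v(T). For z = (1 + tT)x the
    terms of first order in (1 - tT)(1 + tT)x cancel, so that this lower bound
    becomes an upper bound for the norm of z. *)
Lemma lumer_bound T (t : R) x : 0 <= t -> t * numerical_radius T < 1 ->
  rnorm (x + ofreal k t *: T x) <=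
    (1 + t ^+ 2 * opnorm T ^+ 2) / (1 - t * numerical_radius T) * rnorm x.
Proof.
move=> t0 tv.
have d0 : 0 < 1 - t * numerical_radius T by lra.
have low z : (1 - t * numerical_radius T) * rnorm z <= rnorm (z - ofreal k t *: T z).
  have [->|z0] := eqVneq z 0; first by rewrite rnorm0 mulr0 rnorm_ge0.
  have [f f1 fz] := norming_functional_unit z0.
  have := realpart_functional_le f (z - ofreal k t *: T z).
  rewrite f1 mul1r; apply: le_trans.
  have -> : f (z - ofreal k t *: T z) = f z - ofreal k t *: f (T z).
    by rewrite linearB linearZ.
  rewrite realpartB realpart_ofrealZ fz ofrealK.
  have := ler_wpM2l t0 (numerical_radius_norming T z0 f1 fz); lra.
rewrite mulrAC ler_pdivlMr// mulrC (le_trans (low _))//.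
have -> : x + ofreal k t *: T x - ofreal k t *: T (x + ofreal k t *: T x) =
  x - ofreal k (t ^+ 2) *: T (T x).
  have -> : T (x + ofreal k t *: T x) = T x + ofreal k t *: T (T x).
    by rewrite linearD linearZ.
  rewrite scalerDr opprD addrA addrK.
  by rewrite scalerA -ofrealM -expr2.
apply: (le_trans (ler_rnormB _ _)); rewrite mulrDl mul1r lerD2l.
rewrite rnormZr ger0_norm ?sqr_ge0// -[leRHS]mulrA ler_wpM2l ?sqr_ge0//.
apply: (le_trans (rnorm_le_opnorm _ _)); rewrite expr2 -[leRHS]mulrA.
by rewrite ler_wpM2l ?opnorm_ge0// rnorm_le_opnorm.
Qed.

Lemma numerical_index_le T :
  numerical_index X * opnorm T <= numerical_radius T.
Proof.
have [T0|T0] := eqVneq (opnorm T) 0; first by rewrite T0 mulr0 numerical_radius_ge0.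
have Tp : 0 < opnorm T by rewrite lt_neqAle eq_sym T0 opnorm_ge0.
rewrite -ler_pdivlMr// mulrC.
apply: ge_inf; first by exists 0 => _ [S _ <-]; exact: numerical_radius_ge0.
exists (ofreal k (opnorm T)^-1 *: T).
  by rewrite /= rnorm_opE opnormZ rnorm_ofreal ?invr_ge0 ?(ltW Tp)// mulVf.
by rewrite numerical_radiusZ rnorm_ofreal// invr_ge0 ltW.
Qed.

Lemma id_bounded : (fun x : X => x) \in bounded_linear X X.
Proof.
by apply/asboolP; split => [a x y//|]; exists 1 => x; rewrite mul1r.
Qed.

Definition id_op : bounded_op X X := BoundedOp id_bounded.

Lemma opnorm_id : opnorm id_op <= 1.
Proof. by apply: opnorm_le => // x; rewrite mul1r. Qed.

Lemma numerical_radius_id : numerical_radius id_op <= 1.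
Proof. exact: le_trans (numerical_radius_le_opnorm _) opnorm_id. Qed.

Lemma rank_one_bounded (a : dual X) (c : X) :
  (fun x : X => a x *: c) \in bounded_linear X X.
Proof.
apply/asboolP; split => [b x z|].
  have -> : a (b *: x + z) = b * a x + a z by exact: linearP.
  by rewrite scalerDl scalerA.
exists (ofreal k (rnorm a * rnorm c)) => x.
rewrite -!ofreal_rnorm -ofrealM ler_ofreal rnormZ.
by rewrite mulrAC ler_wpM2r ?rnorm_ge0// functional_le.
Qed.

Definition rank_one a c : bounded_op X X := BoundedOp (rank_one_bounded a c).

Lemma opnorm_rank_one a c : opnorm (rank_one a c) <= rnorm a * rnorm c.
Proof.
apply: opnorm_le => [|x]; first by rewrite mulr_ge0 ?rnorm_ge0.
by rewrite rnormZ mulrAC ler_wpM2r ?rnorm_ge0// functional_le.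
Qed.

Lemma adjoint_rank_one a c y : adjoint (rank_one a c) y = y c *: a.
Proof.
apply: bounded_op_ext => x /=.
by rewrite /adjoint_fun /= linearZ /= -[RHS]/(y c * a x) mulrC.
Qed.

End numerical_radius_theory.
Arguments id_op {R k X}.

Section topology.
Context {R : realType} {k : scalar_kind}.
Local Notation K := (scalar_field R k).

Lemma ltr_ofreal (a b : R) : (ofreal k a < ofreal k b :> K) = (a < b).
Proof.
by rewrite !lt_neqAle ler_ofreal (inj_eq (@ofreal_inj R k)).
Qed.

Lemma ofreal_gt0 (e : K) : 0 < e -> exists2 d : R, 0 < d & e = ofreal k d.
Proof.
move=> e0; have eE := real_realpartK (gtr0_real e0).
by exists (realpart e); rewrite ?eE// -ltr_ofreal eE ofreal0.
Qed.

Lemma cvg_rnormP {T : Type} {F : set_system T} {FF : Filter F}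
    (V : normedModType K) (f : T -> V) (l : V) :
  f @ F --> l <-> forall e : R, 0 < e -> F [set t | rnorm (l - f t) < e].
Proof.
rewrite cvgrPdist_lt; split=> [fl e e0|fl e /ofreal_gt0[d d0 ->]].
  have := fl (ofreal k e); rewrite -ofreal0 ltr_ofreal => /(_ e0).
  by apply: filterS => t; rewrite -ofreal_rnorm ltr_ofreal.
by apply: filterS (fl _ d0) => t; rewrite -ofreal_rnorm ltr_ofreal.
Qed.

Lemma scalar_decomp (a : K) :
  a = ofreal k (realpart a) - ofreal k (realpart (imag_unit * a)) * imag_unit.
Proof.
rewrite /imag_unit; case: k a => /= [a|[a1 a2]]; first by rewrite mulr0 subr0.
apply/eqP; rewrite eq_complex /= !(mulr0, mul0r, mulr1, mul1r, subr0, addr0, sub0r, add0r, opprK).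
by rewrite ?oppr0 ?eqxx.
Qed.

Lemma scale_real_continuous (V : normedModType K) (c : V) :
  continuous (fun s : R => ofreal k s *: c).
Proof.
move=> s; apply/cvg_rnormP => e e0.
have d0 : 0 < e / (rnorm c + 1) by rewrite divr_gt0// ltr_wpDl ?rnorm_ge0.
have : \forall t \near s, `|s - t| < e / (rnorm c + 1).
  by have /cvgrPdist_lt := @cvg_id _ (nbhs s); apply.
apply: filterS => t; rewrite /= ltr_pdivlMr ?ltr_wpDl ?rnorm_ge0// => st.
rewrite -scalerBl -ofrealN -ofrealD rnormZr; apply: le_lt_trans st.
by rewrite ler_wpM2l// lerDl.
Qed.

(** A disc of scalars is the image of a square of pairs of reals; through this
    parametrization the compactness of real segments suffices. *)
Lemma precompact_line (V : normedModType K) (c : V) (M : R) :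
  precompact [set s *: c | s in [set s : K | rnorm (s : K^o) <= M]].
Proof.
pose g (u : R * R) : V := ofreal k u.1 *: c + ofreal k u.2 *: (imag_unit *: c).
have gc : continuous g.
  move=> u; apply: cvgD.
    apply: (@cvg_comp _ _ _ fst (fun s => ofreal k s *: c) _ (nbhs u.1)).
      exact: cvg_fst.
    exact: scale_real_continuous.
  apply: (@cvg_comp _ _ _ snd (fun s => ofreal k s *: (imag_unit *: c)) _ (nbhs u.2)).
    exact: cvg_snd.
  exact: scale_real_continuous.
pose A := `[- M, M]%classic `*` `[- M, M]%classic : set (R * R).
have cA : compact (g @` A).
  apply: continuous_compact; first exact: continuous_subspaceT.
  by apply: compact_setX; exact: segment_compact.
apply: (@precompact_subset _ _ (g @` A)); last first.
  by apply: compact_precompact cA; exact: norm_hausdorff.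
move=> _ [s /= sM <-].
exists (realpart s, - realpart (imag_unit * s)); last first.
  by rewrite /g /= scalerA -scalerDl [in RHS](scalar_decomp s) ofrealN mulNr.
have sM1 : `|realpart s| <= M by exact: le_trans (normr_realpart_le _) sM.
have sM2 : `|realpart (imag_unit * s)| <= M.
  apply: le_trans sM; apply: (le_trans (normr_realpart_le _)).
  rewrite rnorm_scalarM ler_piMl ?rnorm_ge0// /rnorm /imag_unit.
  by case: k => /=; rewrite ?normr0// expr0n expr1n add0r sqrtr1.
by split; rewrite /= in_itv/= -ler_norml ?normrN.
Qed.

End topology.

Section state_functionals.
Context {R : realType} {k : scalar_kind} {X : normedModType (scalar_field R k)}.
Local Notation K := (scalar_field R k).
Implicit Types (S T : bounded_op X X) (x : X) (y f : dual X) (n : dual (dual X)).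

Lemma rank_one_compact (a : dual X) (c : X) : compact_op X (rank_one a c).
Proof.
apply: precompact_subset (precompact_line c (rnorm a)) => _ [x /= x1 <-].
exists (a x) => //=; apply: (le_trans (functional_le a x)).
by rewrite ler_piMr ?rnorm_ge0.
Qed.

Lemma adjoint_norm_le T (c : R) y : 0 <= c -> (forall x, rnorm (T x) <= c * rnorm x) ->
  rnorm (adjoint T y) <= rnorm y * c.
Proof.
move=> c0 Tc; apply: functional_norm_le => [|x]; first by rewrite mulr_ge0 ?rnorm_ge0.
apply: (le_trans (realpart_functional_le y (T x))).
by rewrite -mulrA ler_wpM2l ?rnorm_ge0.
Qed.

Lemma adjoint_norm_le_opnorm T y : rnorm (adjoint T y) <= rnorm y * opnorm T.
Proof. by apply: adjoint_norm_le => [|x]; [exact: opnorm_ge0|exact: rnorm_le_opnorm]. Qed.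

Lemma adjoint_linear (a : K) S T y : adjoint (a *: S + T) y = a *: adjoint S y + adjoint T y.
Proof. by apply: bounded_op_ext => x /=; rewrite /adjoint_fun linearP. Qed.

Lemma adjointD S T y : adjoint (S + T) y = adjoint S y + adjoint T y.
Proof. by have := adjoint_linear 1 S T y; rewrite !scale1r. Qed.

Lemma adjoint0 y : adjoint (0 : bounded_op X X) y = 0.
Proof. by apply: bounded_op_ext => x /=; rewrite /adjoint_fun linear0. Qed.

Lemma adjointZ (a : K) S y : adjoint (a *: S) y = a *: adjoint S y.
Proof. by have := adjoint_linear a S 0 y; rewrite adjoint0 !addr0. Qed.

Lemma adjoint_id y : adjoint id_op y = y.
Proof. by apply: bounded_op_ext. Qed.

Variable nX : 0 < numerical_index X.

Lemma opnorm_le_numerical_radius T :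
  opnorm T <= numerical_radius T / numerical_index X.
Proof. by rewrite ler_pdivlMr// mulrC numerical_index_le. Qed.

(** A real functional r that is dominated by nu times the operator norm and
    almost reaches nu at the identity is almost dominated by nu times
    the numerical radius: compare r(1 + tS) with r(1) for a small t > 0 and
    bound the norm of 1 + tS by [lumer_bound]. The choice of eps does not
    depend on r, as is needed when r is only obtained afterwards. *)
Lemma approximate_state (nu0 err : R) : 0 <= nu0 -> 0 < err -> exists2 eps : R, 0 < eps &
  forall (r : bounded_op X X -> R) (nu : R), 0 <= nu <= nu0 ->
    (forall S T, r (S + T) = r S + r T) ->
    (forall (t : R) S, r (ofreal k t *: S) = t * r S) ->
    (forall S c, 0 <= c -> (forall x, rnorm (x + S x) <= c * rnorm x) ->
       r (id_op + S) <= nu * c) ->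
    nu - eps <= r id_op ->
  forall S, r S <= (nu + err) * numerical_radius S.
Proof.
move=> nu00 err0; pose g := (numerical_index X)^-1.
have g0 : 0 <= g by rewrite invr_ge0 ltW.
(* (1 + t^2 g^2) / (1 - t) is at most 1 + t + O(t^2); D bounds what is left
   after division by t. *)
pose D := 4 * (nu0 + 1) * (g ^+ 2 + 1).
have D0 : 0 < D by rewrite !mulr_gt0 ?ltr_wpDl ?sqr_ge0.
pose t := Num.min (1 / 2) (err / D).
have t0 : 0 < t by rewrite lt_min !divr_gt0.
have t2 : t <= 1 / 2 by rewrite ge_min lexx.
have tD : t * D <= err by rewrite -ler_pdivlMr// ge_min lexx orbT.
exists (t * (err / 2)); first by rewrite mulr_gt0// divr_gt0.
move=> r nu /andP[nu_ge0 nu_le] rD rZ rc rid S.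
have [S0|S0] := eqVneq (numerical_radius S) 0.
  rewrite (numerical_radius_eq0 nX S0).
  have -> : r 0 = 0 by have := rZ 0 0; rewrite scaler0 mul0r.
  by rewrite mulr_ge0 ?numerical_radius_ge0// addr_ge0 ?(ltW err0).
have v0 : 0 < numerical_radius S by rewrite lt_neqAle eq_sym S0 numerical_radius_ge0.
rewrite -ler_pdivrMr// mulrC -rZ; set S' := _ *: S.
have v1 : numerical_radius S' = 1.
  by rewrite numerical_radiusZ rnorm_ofreal ?mulVf// invr_ge0 ltW.
have S'g : opnorm S' <= g by have := opnorm_le_numerical_radius S'; rewrite v1 mul1r.
pose c := (1 + t ^+ 2 * g ^+ 2) / (1 - t).
have t1 : 0 < 1 - t by lra.
have c0 : 0 <= c.
  by apply: divr_ge0 (ltW t1); rewrite addr_ge0// mulr_ge0 ?sqr_ge0.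
have hc x : rnorm (x + (ofreal k t *: S') x) <= c * rnorm x.
  apply: (le_trans (@lumer_bound _ _ _ S' t x (ltW t0) _)); first by rewrite v1; lra.
  rewrite v1 mulr1 ler_wpM2r ?rnorm_ge0// ler_wpM2r ?invr_ge0 ?(ltW t1)//.
  rewrite lerD2l ler_wpM2l ?sqr_ge0// ler_pXn2r ?nnegrE ?opnorm_ge0//.
have := rc _ c c0 hc; rewrite rD rZ => key.
have cE : c = 1 + t * ((1 + t * g ^+ 2) / (1 - t)).
  by rewrite /c; field; rewrite gt_eqF.
have cb : (1 + t * g ^+ 2) / (1 - t) <= 1 + 2 * t * (g ^+ 2 + 1).
  rewrite ler_pdivrMr//.
  have : 0 <= (1 - 2 * t) * t * (g ^+ 2 + 1).
    by apply: mulr_ge0; [apply: mulr_ge0; lra|rewrite addr_ge0 ?sqr_ge0].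
  by lra.
have nc : nu * c <= nu + t * (nu + err / 2).
  rewrite cE mulrDr mulr1 lerD2l mulrCA ler_wpM2l ?(ltW t0)//.
  apply: (le_trans (ler_wpM2l nu_ge0 cb)); rewrite mulrDr mulr1 lerD2l.
  have : nu * (2 * t * (g ^+ 2 + 1)) <= (nu0 + 1) * (2 * t * (g ^+ 2 + 1)).
    by apply: ler_wpM2r; [rewrite !mulr_ge0 ?addr_ge0 ?sqr_ge0 ?(ltW t0)|lra].
  by move: tD; rewrite /D; lra.
by rewrite -(ler_pM2l t0); lra.
Qed.

End state_functionals.

(** * Elementary functionals on the operators *)

Section tensor_functionals.
Context {R : realType} {k : scalar_kind} {X : normedModType (scalar_field R k)}.
Variable nX : 0 < numerical_index X.
Local Notation K := (scalar_field R k).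
Local Notation Lv := (numrad_op nX).
Implicit Types (S T : bounded_op X X) (x : X) (y f : dual X) (n : dual (dual X)).

Definition tensor_fun n y (S : Lv) : K^o := n (adjoint (S : bounded_op X X) y).

Lemma tensor_bounded n y : tensor_fun n y \in bounded_linear Lv K^o.
Proof.
apply/asboolP; split => [a S T|].
  by rewrite /tensor_fun adjoint_linear linearP.
exists (ofreal k (rnorm n * rnorm y / numerical_index X)) => S.
rewrite -!ofreal_rnorm -ofrealM ler_ofreal rnorm_numradE.
apply: (le_trans (functional_le _ _)); rewrite -mulrA -[leRHS]mulrA ler_wpM2l ?rnorm_ge0//.
apply: (le_trans (adjoint_norm_le_opnorm _ _)); rewrite ler_wpM2l ?rnorm_ge0//.
by rewrite mulrC; exact: opnorm_le_numerical_radius.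
Qed.

(** The elementary functional n (x) y on the operators. *)
Definition tensor n y : dual Lv := BoundedOp (tensor_bounded n y).

Lemma tensorE n y S : tensor n y (S : Lv) = n (adjoint S y).
Proof. by []. Qed.

Lemma tensor_linearl a n n' y : tensor (a *: n + n') y = a *: tensor n y + tensor n' y.
Proof. exact: bounded_op_ext. Qed.

Lemma tensor_linearr a n y y' : tensor n (a *: y + y') = a *: tensor n y + tensor n y'.
Proof.
apply: bounded_op_ext => S; rewrite /= /tensor_fun.
have -> : adjoint (S : bounded_op X X) (a *: y + y') = a *: adjoint S y + adjoint S y'.
  by rewrite linearP.
by rewrite linearP.
Qed.

Lemma tensor_norm_le n y :
  rnorm (tensor n y) <= rnorm n * rnorm y / numerical_index X.
Proof.
have M0 : 0 <= rnorm n * rnorm y / numerical_index X.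
  by rewrite divr_ge0 ?mulr_ge0 ?rnorm_ge0 ?(ltW nX).
apply: functional_norm_le => // S; rewrite rnorm_numradE.
apply: (le_trans (realpart_functional_le n (adjoint (S : bounded_op X X) y))).
rewrite -mulrA -[leRHS]mulrA ler_wpM2l ?rnorm_ge0//.
apply: (le_trans (adjoint_norm_le_opnorm _ _)); rewrite ler_wpM2l ?rnorm_ge0//.
by rewrite mulrC; exact: opnorm_le_numerical_radius.
Qed.

(** On the rank one operator sending z to a(z) c, n (x) y takes the value
    n(a) y(c), so that the compact operators already detect the full product of
    the norms, whatever the functional does elsewhere. *)
Lemma tensor_norm_ge (f : dual Lv) n y :
  (forall S : Lv, numrad_compact nX S -> f S = tensor n y S) ->
  rnorm n * rnorm y <= rnorm f.
Proof.
move=> fC.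
have step (a : dual X) (c : X) : rnorm (n a) * rnorm (y c) <= rnorm f * (rnorm a * rnorm c).
  have := functional_le f (rank_one a c : Lv).
  rewrite fC; last exact: rank_one_compact.
  rewrite tensorE adjoint_rank_one linearZ /= -[_ *: _]/(y c * n a) rnorm_scalarM mulrC.
  move/le_trans; apply; rewrite ler_wpM2l ?rnorm_ge0// rnorm_numradE.
  exact: le_trans (numerical_radius_le_opnorm _) (opnorm_rank_one _ _).
have step2 a : rnorm (n a) * rnorm y <= rnorm f * rnorm a.
  rewrite -rnormZ; apply: functional_norm_le => [|c]; first by rewrite mulr_ge0 ?rnorm_ge0.
  apply: (le_trans (realpart_le _)).
  by rewrite [(_ *: y) c]/(n a * y c) rnorm_scalarM -mulrA.
have -> : rnorm n * rnorm y = rnorm (ofreal k (rnorm y) *: n).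
  by rewrite rnormZr ger0_norm ?rnorm_ge0// mulrC.
apply: functional_norm_le => [|a]; first exact: rnorm_ge0.
apply: (le_trans (realpart_le _)); apply: le_trans (step2 a).
by rewrite [(_ *: n) a]/(ofreal k (rnorm y) * n a) rnorm_scalarM rnorm_ofreal ?rnorm_ge0// mulrC.
Qed.

Lemma realpart_adjoint_shift n y S (c : R) : 0 <= c ->
  (forall x, rnorm (x + S x) <= c * rnorm x) ->
  realpart (n (adjoint (id_op + S) y)) <= rnorm n * rnorm y * c.
Proof.
move=> c0 Sc; apply: (le_trans (realpart_functional_le _ _)).
rewrite -mulrA ler_wpM2l ?rnorm_ge0//; exact: adjoint_norm_le.
Qed.

Lemma tensor_almost_state (nu0 err : R) : 0 <= nu0 -> 0 < err -> exists2 eps : R, 0 < eps &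
  forall n y, rnorm n * rnorm y <= nu0 ->
    rnorm n * rnorm y - eps <= realpart (n y) ->
  rnorm (tensor n y) <= rnorm n * rnorm y + err.
Proof.
move=> nu00 err0; have [eps e0 H] := approximate_state nX nu00 err0.
exists eps => // n y ny nyr; apply: functional_norm_le.
  by rewrite addr_ge0 ?(ltW err0)// mulr_ge0 ?rnorm_ge0.
move=> S; rewrite rnorm_numradE.
apply: (H (fun S => realpart (tensor n y S)) (rnorm n * rnorm y)).
- by rewrite ny mulr_ge0 ?rnorm_ge0.
- by move=> T T'; rewrite (linearD (tensor n y)) realpartD.
- by move=> t T; rewrite (linearZ_LR (tensor n y)) realpart_ofrealZ.
- by move=> T c c0 Tc; exact: realpart_adjoint_shift.
- by rewrite tensorE adjoint_id.
Qed.

(** State pairs of the dual space do not come from state pairs of X in general,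
    but n (x) y is dominated by the operator norm and is 1 at the identity, which
    suffices by [approximate_state]. *)
Lemma tensor_state n y : state_pairs (dual X) (n, y) -> rnorm (tensor n y) <= 1.
Proof.
move=> [/= n1 y1 ny]; apply/ler_addgt0Pr => e e0.
have [eps eps0 H] := tensor_almost_state ler01 e0.
by have := H n y; rewrite n1 y1 mulr1 ny realpart1; apply => //; lra.
Qed.

Lemma numerical_radius_adjoint_le T : numerical_radius (adjoint T) <= numerical_radius T.
Proof.
apply: sup_image_le => [|[n y] ny /=]; first exact: numerical_radius_ge0.
have := functional_le (tensor n y) (T : Lv); rewrite rnorm_numradE => /le_trans; apply.
by rewrite ler_piMl ?numerical_radius_ge0// tensor_state.
Qed.

End tensor_functionals.

(** * Limits along ultrafilters *)

Lemma ultra_fmap {I J : Type} (U : set_system I) {FU : UltraFilter U} (f : I -> J) :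
  UltraFilter [set A | U (f @^-1` A)].
Proof.
split=> [|G GG fG]; first exact: fmap_proper_filter.
apply/seteqP; split => A; last exact: fG.
move=> GA; have [//|nA] := in_ultra_setVsetC (f @^-1` A) FU.
have : G (~` A) by exact: fG.
by move=> /(filterI GA); rewrite setICr => /filter_ex[].
Qed.

Section ultralimit.
Context {R : realType} {I : Type} (U : set_system I) {FU : UltraFilter U}.
Implicit Types f g : I -> R.

Lemma ultra_bounded_cvg f (M : R) : U [set p | `|f p| <= M] -> cvg (f @ U).
Proof.
move=> fM; have ff := @ultra_fmap _ _ U FU f.
have := @segment_compact R (- M) M; rewrite compact_ultra => /(_ (f @ U) ff)[].
  by apply: (@filterS _ U _ _ _ _ fM) => p; rewrite /= in_itv/= ler_norml.
by move=> l [_ fl]; apply/cvg_ex; exists l.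
Qed.

End ultralimit.

Section almost_norming.
Context {R : realType} {k : scalar_kind} {V : normedModType (scalar_field R k)}.

Lemma almost_norming (f : dual V) (d : R) : 0 < d ->
  exists2 x : V, rnorm x <= 1 & rnorm f - d <= realpart (f x).
Proof.
move=> d0; have [fd|fd] := leP (rnorm f) d.
  by exists 0; rewrite ?rnorm0// linear0 realpart0; lra.
apply: contrapT => nx.
suff : rnorm f <= rnorm f - d by lra.
apply: functional_norm_le => [|x]; first by lra.
have [->|x0] := eqVneq x 0; first by rewrite linear0 realpart0 rnorm0 mulr0.
have nx0 : 0 < rnorm x.
  by rewrite lt_def rnorm_ge0 andbT; apply: contra_neq x0 => /rnorm_eq0.
rewrite -ler_pdivrMr//; apply: contrapT => /negP; rewrite -ltNge => lt.
apply: nx; exists (ofreal k (rnorm x)^-1 *: x).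
  by rewrite rnormZr ger0_norm ?invr_ge0 ?(ltW nx0)// mulVf// gt_eqF.
by rewrite linearZ /= realpart_ofrealZ mulrC ltW.
Qed.

End almost_norming.

Section ultralimits.
Context {R : realType} {I : Type} (U : set_system I) {FU : UltraFilter U}.
Implicit Types f g : I -> R.

Definition ulim f : R := lim (f @ U).

Lemma ulimP f (M : R) : U [set p | `|f p| <= M] -> f @ U --> ulim f.
Proof. by move=> fM; exact: ultra_bounded_cvg fM. Qed.

Lemma ulim_near f (M e : R) : U [set p | `|f p| <= M] -> 0 < e ->
  U [set p | `|ulim f - f p| < e].
Proof. by move=> /ulimP /cvgrPdist_lt; apply. Qed.

Lemma ulim_eq f (l : R) : f @ U --> l -> ulim f = l.
Proof. by move=> fl; apply: cvg_lim. Qed.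

Lemma ulim_le f (M c : R) : U [set p | `|f p| <= M] -> U [set p | f p <= c] ->
  ulim f <= c.
Proof.
move=> fM fc; apply/ler_addgt0Pr => e e0.
have [p [/= p1 p2]] := @filter_ex _ U _ _ (filterI fc (ulim_near fM e0)).
by have := ler_norm (ulim f - f p); lra.
Qed.

Lemma ulimN f (M : R) : U [set p | `|f p| <= M] -> ulim (fun p => - f p) = - ulim f.
Proof. by move=> fM; apply: ulim_eq; apply: cvgN; exact: ulimP fM. Qed.

Lemma ulim_ge f (M c : R) : U [set p | `|f p| <= M] -> U [set p | c <= f p] ->
  c <= ulim f.
Proof.
move=> fM fc; rewrite -lerN2 -(ulimN fM); apply: (@ulim_le _ M).
  by apply: filterS fM => p /=; rewrite normrN.
by apply: filterS fc => p /=; rewrite lerN2.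
Qed.

Lemma ulimD f g (M N : R) : U [set p | `|f p| <= M] -> U [set p | `|g p| <= N] ->
  ulim (fun p => f p + g p) = ulim f + ulim g.
Proof.
by move=> fM gN; apply: ulim_eq; apply: cvgD; [exact: ulimP fM|exact: ulimP gN].
Qed.

Lemma ulimZ (a : R) f (M : R) : U [set p | `|f p| <= M] ->
  ulim (fun p => a * f p) = a * ulim f.
Proof. by move=> fM; apply: ulim_eq; apply: cvgMl_tmp; exact: ulimP fM. Qed.

Lemma bddD f g (M N : R) : U [set p | `|f p| <= M] -> U [set p | `|g p| <= N] ->
  U [set p | `|f p + g p| <= M + N].
Proof.
move=> fM gN; apply: filterS (filterI fM gN) => p [/= p1 p2].
by rewrite (le_trans (ler_normD _ _))// lerD.
Qed.

Lemma ulim_mono f g (M N : R) : U [set p | `|f p| <= M] -> U [set p | `|g p| <= N] ->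
  U [set p | f p <= g p] -> ulim f <= ulim g.
Proof.
move=> fM gN fg; apply/ler_addgt0Pr => e e0.
have e2 : 0 < e / 2 by lra.
have [p [[/= p1 p2] p3]] := @filter_ex _ U _ _ (filterI (filterI (ulim_near fM e2) (ulim_near gN e2)) fg).
move: p1 p2; rewrite !ltr_norml => /andP[_ p1] /andP[p2 _].
by move: p1 p2 p3; rewrite /mkset; lra.
Qed.

Context {k : scalar_kind}.
Local Notation K := (scalar_field R k).

(** Weak star compactness of balls of the dual. The limit is taken on real
    parts, where bounded families converge along any ultrafilter. *)
Lemma limit_functional (V : normedModType K) (F : I -> dual V) (M : R) : 0 <= M ->
  U [set p | rnorm (F p) <= M] ->
  exists2 f : dual V, rnorm f <= M &
    forall v e, 0 < e -> U [set p | rnorm (F p v - f v : K^o) < e].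
Proof.
move=> M0 FM.
have bd v : U [set p | `|realpart (F p v)| <= M * rnorm v].
  apply: filterS FM => p /= pM; apply: (le_trans (normr_realpart_le _)).
  by apply: (le_trans (functional_le _ _)); rewrite ler_wpM2r ?rnorm_ge0.
pose r v := ulim (fun p => realpart (F p v)).
have [f fr fM] : exists2 f : dual V, forall v, realpart (f v) = r v & rnorm f <= M.
  apply: functional_of_real_part => // [x y|t x|x].
  - rewrite /r -(ulimD (bd x) (bd y)); congr (ulim _).
    by apply/funext => p; rewrite linearD realpartD.
  - rewrite /r -(ulimZ t (bd x)); congr (ulim _).
    by apply/funext => p; rewrite linearZ /= realpart_ofrealZ.
  - apply: (ulim_le (bd x)); apply: filterS (bd x) => p /=.
    exact: le_trans (ler_norm _).
exists f => // v e e0.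
have e2 : 0 < e / 2 by lra.
apply: filterS (filterI (ulim_near (bd v) e2) (ulim_near (bd (imag_unit *: v)) e2)) => p [/= p1 p2].
apply: (le_lt_trans (rnorm_le_parts _)).
move: p1 p2; rewrite -[ulim _]/(r v) -[ulim _]/(r (imag_unit *: v)) -!fr.
rewrite !linearZ /= -[_ *: F p v]/(_ * F p v) -[_ *: f v]/(_ * f v).
rewrite -!realpartB -mulrBr -(normrN (realpart (f v - _))) -(normrN (realpart (_ * _))).
by rewrite -!realpartN -mulrN !opprB; lra.
Qed.

(** If T' w_p stayed large, it would be so at some z_p in the unit ball; by compactness
    T z_p converges along the ultrafilter to some c, and then w_p (T z_p) is
    close to w_p c, which vanishes in the limit. *)
Lemma adjoint_compact_vanish (X : normedModType K) (T : bounded_op X X)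
    (w : I -> dual X) (M : R) : compact_op X T ->
  U [set p | rnorm (w p) <= M] ->
  (forall x e, 0 < e -> U [set p | rnorm (w p x : K^o) < e]) ->
  forall e, 0 < e -> U [set p | rnorm (adjoint T (w p)) < e].
Proof.
move=> cT wM wx e e0.
have [//|nU] := in_ultra_setVsetC [set p | rnorm (adjoint T (w p)) < e] FU.
have e2 : 0 < e / 2 by lra.
have ex p : exists x : X, rnorm x <= 1 /\
    rnorm (adjoint T (w p)) - e / 2 <= realpart (adjoint T (w p) x).
  by have [x x1 x2] := almost_norming (adjoint T (w p)) e2; exists x.
pose z p := projT1 (cid (ex p)).
have z1 p : rnorm (z p) <= 1 := (projT2 (cid (ex p))).1.
have z2 p : rnorm (adjoint T (w p)) - e / 2 <= realpart (w p (T (z p))) :=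
  (projT2 (cid (ex p))).2.
have uz := @ultra_fmap _ _ U FU (fun p => T (z p)).
move: cT; rewrite /compact_op /= precompactE compact_ultra => /(_ _ uz)[].
  apply: (@filterS _ U _ setT) => [p _|]; last exact: filterT.
  by apply: subset_closure; exists (z p) => //=; exact: z1.
move=> c [_ /cvg_rnormP zc].
have M10 : 0 < `|M| + 1 by rewrite ltr_wpDl.
have d0 : 0 < e / 4 / (`|M| + 1) by rewrite !divr_gt0.
have e4 : 0 < e / 4 by rewrite divr_gt0.
have [p [[/= p1 p2] [/= p3 p4]]] := @filter_ex _ U _ _ (filterI (filterI (zc _ d0) (wx c _ e4)) (filterI nU wM)).
exfalso; move: p3 => /negP; rewrite -leNgt => p3.
have := z2 p; have := realpart_le (w p (T (z p))).
have : rnorm (w p (T (z p)) : K^o) <= rnorm (w p c : K^o) + rnorm (w p) * rnorm (c - T (z p)).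
  rewrite -[w p (T (z p))](subrK (w p c)) -linearB (le_trans (ler_rnormD _ _))// addrC lerD2l.
  by rewrite (rnorm_distC c) functional_le.
have : rnorm (w p) * rnorm (c - T (z p)) <= e / 4.
  apply: (@le_trans _ _ ((`|M| + 1) * (e / 4 / (`|M| + 1)))).
    apply: ler_pM; rewrite ?rnorm_ge0//; last exact: ltW.
    by apply: (le_trans p4); have := ler_norm M; lra.
  by rewrite mulrC divfK// gt_eqF.
by move: p2 p3; lra.
Qed.

End ultralimits.

(** * The defect of an M-projection *)

Section M_projection.
Context {R : realType} {k : scalar_kind} {X : normedModType (scalar_field R k)}.
Variable nX : 0 < numerical_index X.
Local Notation K := (scalar_field R k).
Local Notation Lv := (numrad_op nX).
Local Notation J := (numrad_compact nX).
Implicit Types (S T : bounded_op X X) (x : X) (y : dual X) (n : dual (dual X)) (f : dual Lv).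

Variable P : {linear dual Lv -> dual Lv}.
Hypothesis PP : forall f, P (P f) = P f.
Hypothesis kerP : [set f | P f = 0] = annihilator J.
Hypothesis normP : forall f, rnorm f = rnorm (P f) + rnorm (f - P f).

Lemma projection_agree f (C : Lv) : J C -> P f C = f C.
Proof.
move=> JC; have : annihilator J (P f - f).
  by rewrite -kerP /= linearB /= PP subrr.
by move=> /(_ C JC) /eqP; rewrite bounded_opBE subr_eq0 => /eqP.
Qed.

Lemma projection_eq (f f' : dual Lv) :
  (forall C : Lv, J C -> f C = f' C) -> P f = P f'.
Proof.
move=> ff'; have : annihilator J (f - f').
  by move=> C JC; rewrite bounded_opBE ff'// subrr.
by rewrite -kerP /= linearB /= => /eqP; rewrite subr_eq0 => /eqP.
Qed.

Lemma projection_norm_le f : rnorm (P f) <= rnorm f.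
Proof. by rewrite [leRHS]normP lerDl rnorm_ge0. Qed.

Lemma projection_tensor_ge n y : rnorm n * rnorm y <= rnorm (P (tensor nX n y)).
Proof. by apply: tensor_norm_ge => S JS; exact: projection_agree. Qed.

Lemma rnorm_id_le : rnorm (id_op : Lv) <= 1.
Proof. by rewrite rnorm_numradE numerical_radius_id. Qed.

Lemma realpart_at_id_le (f : dual Lv) : realpart (f (id_op : Lv)) <= rnorm f.
Proof.
apply: (le_trans (realpart_functional_le f _)).
by rewrite ler_piMr ?rnorm_ge0// rnorm_id_le.
Qed.

Definition defect_fun n y : K^o := P (tensor nX n y) (id_op : Lv) - n y.

Lemma defect_bounded n : defect_fun n \in bounded_linear (dual X) K^o.
Proof.
apply/asboolP; split => [a y y'|].
  by rewrite /defect_fun tensor_linearr !linearP bounded_opDE bounded_opZE addrACA [in RHS]scalerDr.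
exists (ofreal k (rnorm n * ((numerical_index X)^-1 + 1))) => y.
rewrite -!ofreal_rnorm -ofrealM ler_ofreal (le_trans (ler_rnormB _ _))//.
rewrite mulrDr mulrDl mulr1 lerD ?functional_le//.
apply: (le_trans (functional_le _ _)); rewrite mulrAC.
apply: (@le_trans _ _ (rnorm (P (tensor nX n y)))).
  by rewrite ler_piMr ?rnorm_ge0 ?rnorm_id_le.
exact: le_trans (projection_norm_le _) (tensor_norm_le _ _ _).
Qed.

(** How far P is from fixing the elementary functional n (x) y, read off at the
    identity. A limit of states with limit points n and y may differ from
    n (x) y, but agrees with it on compact operators; as P depends only on these,
    the defect can be computed from the limit state. *)
Definition defect n : dual (dual X) := BoundedOp (defect_bounded n).

Lemma defectE n y : defect n y = P (tensor nX n y) (id_op : Lv) - n y.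
Proof. by []. Qed.

Lemma defect_linear (a : K) n n' : defect (a *: n + n') = a *: defect n + defect n'.
Proof.
apply: bounded_op_ext => y; rewrite bounded_opDE bounded_opZE !defectE.
rewrite tensor_linearl linearP !bounded_opDE !bounded_opZE.
by rewrite scalerBr addrACA -opprD.
Qed.

Definition defect_bound := (numerical_index X)^-1 + 1.

Lemma defect_norm_le n : rnorm (defect n) <= defect_bound * rnorm n.
Proof.
have b0 : 0 <= defect_bound * rnorm n.
  by rewrite mulr_ge0 ?rnorm_ge0// addr_ge0// invr_ge0 ltW.
apply: functional_norm_le => // y; apply: (le_trans (realpart_le _)).
rewrite defectE (le_trans (ler_rnormB _ _))// /defect_bound mulrDl mul1r mulrDl.
rewrite lerD ?functional_le//; apply: (le_trans (functional_le _ _)).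
apply: (@le_trans _ _ (rnorm (P (tensor nX n y)))).
  by rewrite ler_piMr ?rnorm_ge0 ?rnorm_id_le.
apply: (le_trans (projection_norm_le _)); apply: (le_trans (tensor_norm_le _ _ _)).
by rewrite [leLHS]mulrC mulrA.
Qed.

(** If n almost attains its norm at y, then n (x) y has norm almost |n| |y|, and
    P(n (x) y) has at least this norm by [tensor_norm_ge]. The norm identity
    leaves almost nothing for n (x) y - P(n (x) y), so the defect of n almost
    vanishes at y and cannot lower the value there. *)
Lemma defect_skew (s : R) n : rnorm n <= rnorm (n + ofreal k s *: defect n).
Proof.
apply/ler_addgt0Pr => e e0.
pose err := e / 2 / (`|s| + 1).
have s1 : 0 < `|s| + 1 by rewrite ltr_wpDl.
have err0 : 0 < err by rewrite !divr_gt0.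
have [eps eps0 H] := tensor_almost_state nX (rnorm_ge0 n) err0.
pose d := Num.min eps (e / 2).
have d0 : 0 < d by rewrite lt_min eps0 divr_gt0.
have [d1 d2] : d <= eps /\ d <= e / 2 by rewrite !ge_min !lexx orbT.
have [y y1 yn] := almost_norming n d0.
have nu1 : rnorm n * rnorm y <= rnorm n by rewrite ler_piMr ?rnorm_ge0.
have tn : rnorm (tensor nX n y) <= rnorm n * rnorm y + err.
  by apply: H => //; lra.
have small : rnorm (tensor nX n y - P (tensor nX n y)) <= err.
  by move: tn; rewrite normP; have := projection_tensor_ge n y; lra.
have dsmall : `|realpart (defect n y)| <= err.
  apply: (le_trans (normr_realpart_le _)).
  have := functional_le (tensor nX n y - P (tensor nX n y)) (id_op : Lv).
  rewrite bounded_opBE tensorE adjoint_id rnorm_distC -defectE.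
  move=> /le_trans; apply; apply: le_trans small.
  by rewrite ler_piMr ?rnorm_ge0 ?rnorm_id_le.
have := realpart_functional_le (n + ofreal k s *: defect n) y.
rewrite bounded_opDE bounded_opZE realpartD realpart_ofrealZ.
have : rnorm (n + ofreal k s *: defect n) * rnorm y <= rnorm (n + ofreal k s *: defect n).
  by rewrite ler_piMr ?rnorm_ge0.
have : `|s * realpart (defect n y)| <= e / 2.
  rewrite normrM; apply: (@le_trans _ _ ((`|s| + 1) * err)).
    by apply: ler_pM => //; lra.
  by rewrite mulrC divfK// gt_eqF.
rewrite ler_norml => /andP[]; lra.
Qed.

Lemma defectZ (t : R) n : defect (ofreal k t *: n) = ofreal k t *: defect n.
Proof.
have d0 : defect 0 = 0.
  by have := defect_linear (-1) 0 0; rewrite !scaleN1r oppr0 addr0 addNr.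
by rewrite -[_ *: n]addr0 defect_linear d0 addr0.
Qed.

(** Applying 1 - hG leaves n - h^2 G^2 n, as in [nrm_step]. *)
Lemma defect_second_order (h : R) n :
  rnorm (n + ofreal k h *: defect n) <=
  (1 + h ^+ 2 * ((numerical_index X)^-1 + 1) ^+ 2) * rnorm n.
Proof.
set g := _^-1 + 1; have g0 : 0 <= g by rewrite addr_ge0// invr_ge0 ltW.
set m := n + _.
apply: (le_trans (defect_skew (- h) m)).
have -> : m + ofreal k (- h) *: defect m =
    n - ofreal k (h ^+ 2) *: defect (defect n).
  rewrite /m [n + _]addrC defect_linear ofrealN scaleNr scalerDr opprD.
  rewrite scalerA -ofrealM -expr2 [X in X + _]addrC -addrA; congr (n + _).
  by rewrite [- _ - _]addrC addrA subrr add0r.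
apply: (le_trans (ler_rnormB _ _)); rewrite mulrDl mul1r lerD2l rnormZr.
rewrite ger0_norm ?sqr_ge0// -[leRHS]mulrA ler_wpM2l ?sqr_ge0//.
apply: (le_trans (defect_norm_le _)).
by rewrite expr2 -[leRHS]mulrA ler_wpM2l// defect_norm_le.
Qed.

End M_projection.

(** * The asymptotic norm and its conjugate *)

Section asymptotic_norm.
Context {R : realType} {k : scalar_kind} {X : normedModType (scalar_field R k)}.
Variable nX : 0 < numerical_index X.
Local Notation K := (scalar_field R k).
Local Notation Lv := (numrad_op nX).
Local Notation J := (numrad_compact nX).
Implicit Types (S T : bounded_op X X) (x : X) (y : dual X) (n : dual (dual X)).

Variable P : {linear dual Lv -> dual Lv}.
Hypothesis PP : forall f, P (P f) = P f.
Hypothesis kerP : [set f | P f = 0] = annihilator J.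
Hypothesis normP : forall f, rnorm f = rnorm (P f) + rnorm (f - P f).
Hypothesis J0 : J 0.
Hypothesis J_linear : forall (a : K) S T, J S -> J T -> J (a *: S + T).

Context {I : Type} (U : set_system I) {FU : UltraFilter U} (w : I -> dual X).
Hypothesis w_le2 : U [set p | rnorm (w p) <= 2].
Hypothesis w_vanish : forall x e, 0 < e -> U [set p | rnorm (w p x : K^o) < e].

(** The limit of |y + S' w_p| for all pairs (y, S); at S = 1 it is the asymptotic
    norm of y, and S = 0 gives back the norm. The operators are kept as a
    second variable to extend functionals from X' to the operators. *)
Definition asym (y : dual X) (S : bounded_op X X) : R :=
  ulim U (fun p => rnorm (y + adjoint S (w p))).

Lemma asym_bounded y S :
  U [set p | `|rnorm (y + adjoint S (w p))| <= rnorm y + 2 * opnorm S].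
Proof.
apply: filterS w_le2 => p /= wp; rewrite ger0_norm ?rnorm_ge0//.
apply: (le_trans (ler_rnormD _ _)); rewrite lerD2l.
apply: (le_trans (adjoint_norm_le_opnorm _ _)).
by rewrite ler_wpM2r ?opnorm_ge0.
Qed.

Lemma asymD y S y' S' : asym (y + y') (S + S') <= asym y S + asym y' S'.
Proof.
rewrite /asym -(ulimD (asym_bounded y S) (asym_bounded y' S')).
apply: (ulim_mono (asym_bounded _ _) (bddD (asym_bounded y S) (asym_bounded y' S'))).
by apply: nearW => p; rewrite /mkset adjointD addrACA ler_rnormD.
Qed.

Lemma asymZ (t : R) y S : 0 <= t ->
  asym (ofreal k t *: y) (ofreal k t *: S) = t * asym y S.
Proof.
move=> t0; rewrite /asym -(ulimZ t (asym_bounded y S)); congr (ulim U _).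
by apply/funext => p; rewrite adjointZ -scalerDr rnormZr ger0_norm.
Qed.

Lemma asym_shift_le y S (c : R) : 0 <= c -> (forall x, rnorm (S x) <= c * rnorm x) ->
  asym (adjoint S y) S <= c * asym y id_op.
Proof.
move=> c0 Sc; rewrite /asym -(ulimZ c (asym_bounded y id_op)).
apply: (ulim_mono (asym_bounded _ _)) => [|]; last first.
  apply: nearW => p; rewrite /mkset adjoint_id mulrC.
  have -> : adjoint S y + adjoint S (w p) = adjoint S (y + w p) by rewrite linearD.
  exact: adjoint_norm_le.
instantiate (1 := c * (rnorm y + 2 * opnorm (id_op : bounded_op X X))).
apply: filterS (asym_bounded y id_op) => p; rewrite /mkset normrM (ger0_norm c0).
exact: ler_wpM2l.
Qed.

Lemma asym_compact S : J S -> asym 0 S = 0.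
Proof.
move=> JS; apply/eqP; rewrite eq_le; apply/andP; split; last first.
  by apply: (ulim_ge (asym_bounded 0 S)); apply: nearW => p; exact: rnorm_ge0.
apply/ler_addgt0Pr => e e0; rewrite add0r; apply: (ulim_le (asym_bounded 0 S)).
apply: filterS (adjoint_compact_vanish JS w_le2 w_vanish e0) => p; rewrite /mkset.
by rewrite add0r => /ltW.
Qed.

Definition asym_norm y := asym y id_op.

Lemma asym_normE y : asym_norm y = ulim U (fun p => rnorm (y + w p)).
Proof. by congr (ulim U _); apply/funext => p; rewrite adjoint_id. Qed.

Lemma asym0 y : asym y 0 = rnorm y.
Proof.
apply: ulim_eq; rewrite (_ : (fun _ => _) = fun=> rnorm y); first exact: cvg_cst.
by apply/funext => p; rewrite adjoint0 addr0.
Qed.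

(** w_p vanishes pointwise, and the norm is lower semicontinuous for pointwise
    convergence. *)
Lemma asym_norm_ge y : rnorm y <= asym_norm y.
Proof.
apply/ler_addgt0Pr => e e0.
have e2 : 0 < e / 2 by lra.
have [x x1 yx] := almost_norming y e2.
rewrite -lerBlDr; apply: (ulim_ge (asym_bounded y id_op)).
apply: filterS (w_vanish x e2) => p; rewrite /mkset => wx; rewrite adjoint_id.
have := realpart_functional_le (y + w p) x; rewrite bounded_opDE realpartD.
have := normr_realpart_le (w p x); rewrite ler_norml => /andP[w1 _].
have : rnorm (y + w p) * rnorm x <= rnorm (y + w p) by rewrite ler_piMr ?rnorm_ge0.
lra.
Qed.

Lemma asym_norm0 : asym_norm 0 <= 2.
Proof.
apply: (ulim_le (asym_bounded 0 id_op)); apply: filterS w_le2 => p; rewrite /mkset.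
by rewrite add0r adjoint_id.
Qed.

Definition asym_conj n : R := sup [set realpart (n y) - asym_norm y | y in [set: dual X]].

Lemma asym_conj_bounded n y : rnorm n <= 1 -> realpart (n y) - asym_norm y <= 0.
Proof.
move=> n1; rewrite subr_le0; apply: le_trans (asym_norm_ge y).
by apply: (le_trans (realpart_functional_le n y)); rewrite ler_piMl ?rnorm_ge0.
Qed.

Lemma asym_conj_ge n y : rnorm n <= 1 -> realpart (n y) - asym_norm y <= asym_conj n.
Proof.
move=> n1; apply: (@le_sup_image _ _ setT (fun y => realpart (n y) - asym_norm y) 0) => //.
by move=> y' _; exact: asym_conj_bounded.
Qed.

Lemma asym_conj_le n (c : R) : (forall y, realpart (n y) - asym_norm y <= c) ->
  asym_conj n <= c.
Proof.
move=> nc; apply: ge_sup; first by exists (realpart (n 0) - asym_norm 0), 0.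
by move=> _ [y _ <-].
Qed.

Lemma asym_conj_le0 n : rnorm n <= 1 -> asym_conj n <= 0.
Proof. by move=> n1; apply: asym_conj_le => y; exact: asym_conj_bounded. Qed.

Lemma asym_conj_ge2 n : rnorm n <= 1 -> - 2 <= asym_conj n.
Proof.
move=> n1; apply: le_trans (asym_conj_ge 0 n1).
by rewrite linear0 realpart0; have := asym_norm0; lra.
Qed.

Lemma asym_conj_approx n (e : R) : rnorm n <= 1 -> 0 < e ->
  exists y, asym_conj n - e <= realpart (n y) - asym_norm y.
Proof.
move=> n1 e0; apply: contrapT => /forallNP ny.
suff : asym_conj n <= asym_conj n - e by lra.
by apply: asym_conj_le => y; have /negP := ny y; rewrite -ltNge => /ltW.
Qed.

(** The extension of Re n to all pairs (y, S) below the asymptotic norm whose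
    value at (0, 1) is as large as the conjugate permits. *)
Lemma asym_extension n : rnorm n <= 1 ->
  exists L : dual X -> bounded_op X X -> R,
  [/\ forall y y' S S', L (y + y') (S + S') = L y S + L y' S',
      forall (t : R) y S, L (ofreal k t *: y) (ofreal k t *: S) = t * L y S,
      forall y S, L y S <= asym y S,
      forall y, L y 0 = realpart (n y) &
      - asym_conj n <= L 0 id_op].
Proof.
move=> n1.
pose E := (realify (dual X) * realify (bounded_op X X))%type.
pose q (e : E) : R := asym e.1 e.2.
have sq : sublinear q.
  split=> [e e'|t e t0]; first exact: asymD.
  by rewrite /q /= !realify_scaleE asymZ.
(* The cone prescribes Re n on the pairs (y, 0) and the value - H(n) at (0, 1);
   it lies below the asymptotic norm by definition of H. *)
pose D (e : E) (r : R) := exists y' (t : R), [/\ 0 <= t,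
  e.1 = y' :> dual X, e.2 = ofreal k t *: id_op :> bounded_op X X &
  r = realpart (n y') - t * asym_conj n].
have mD : minorant_cone q D.
  split.
  - exists 0, 0; split => //; first by rewrite ofreal0 scale0r.
    by rewrite linear0 realpart0 mul0r subr0.
  - move=> e e' _ _ [y1 [t1 [t10 e1 e2 ->]]] [y2 [t2 [t20 e1' e2' ->]]].
    exists (y1 + y2), (t1 + t2); split; first exact: addr_ge0.
    + by rewrite -e1 -e1'.
    + by rewrite ofrealD scalerDl -e2 -e2'.
    + by rewrite (linearD n) realpartD; lra.
  - move=> s e _ s0 [y1 [t1 [t10 e1 e2 ->]]].
    exists (ofreal k s *: y1), (s * t1); split; first by rewrite mulr_ge0// ltW.
    + by rewrite -e1.
    + by rewrite ofrealM -scalerA -e2.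
    + by rewrite (linearZ_LR n) realpart_ofrealZ; lra.
  - move=> e _ [y1 [t1 [t10 e1 e2 ->]]]; rewrite /q e1 e2.
    move: t10; rewrite le_eqVlt => /predU1P[<-|t10].
      rewrite ofreal0 scale0r asym0 mul0r subr0.
      by apply: (le_trans (realpart_functional_le n y1)); rewrite ler_piMl ?rnorm_ge0.
    pose y2 := ofreal k t1^-1 *: y1.
    have -> : y1 = ofreal k t1 *: y2.
      by rewrite scalerA -ofrealM divff ?gt_eqF// ofreal1 scale1r.
    rewrite asymZ ?(ltW t10)// (linearZ_LR n) realpart_ofrealZ.
    rewrite -mulrBr ler_pM2l//; have := asym_conj_ge y2 n1.
    rewrite /asym_norm; lra.
have [L [Lq LD]] := hahn_banach sq mD.
have Ladd (y y' : dual X) (S S' : bounded_op X X) :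
    L ((y + y', S + S') : E) = L ((y, S) : E) + L ((y', S') : E).
  exact: (linearD L ((y, S) : E) ((y', S') : E)).
have Lopp (y : dual X) (S : bounded_op X X) : L ((- y, - S) : E) = - L ((y, S) : E).
  exact: (linearN L ((y, S) : E)).
exists (fun y S => L ((y, S) : E)); split.
- exact: Ladd.
- by move=> t y S; exact: (linearZ_LR L t ((y, S) : E)).
- by move=> y S; exact: Lq.
- have h (z : dual X) : realpart (n z) <= L ((z, 0) : E).
    by apply: LD; exists z, 0; split => //; rewrite ?ofreal0 ?scale0r ?mul0r ?subr0.
  move=> y; apply/eqP; rewrite eq_le h andbT.
  have := h (- y); rewrite (linearN n) realpartN -{1}[0 in X in _ <= X](@oppr0 (bounded_op X X)).
  by rewrite Lopp lerN2.
- apply: LD; exists 0, 1; split => //; first by rewrite ofreal1 scale1r.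
  by rewrite linear0 realpart0 sub0r mul1r.
Qed.

(** With L from [asym_extension], r(S) = L(S' y, S) is an almost state: it is
    dominated by N(y) times the norm and r(1) is almost N(y), as y is almost
    optimal. The functional phi with real part r agrees with n (x) y on compact
    operators, because L(0, S) vanishes there. Hence P phi = P(n (x) y) has norm
    at least |n| |y|, and the norm identity gives
    Re (phi - P phi)(1) <= N(y) - |n| |y| up to errors. Here Re phi(1) is almost
    N(y), and (P phi)(1) = (n + G n)(y). *)
Lemma asym_conj_slope n (err : R) : rnorm n < 1 -> 0 < err -> exists2 y,
  asym_conj n - err <= realpart (n y) - asym_norm y &
  rnorm n * rnorm y <= realpart (n y) + realpart (defect normP n y) + err.
Proof.
move=> n1 err0; have n1' := ltW n1.
have n1p : 0 < 1 - rnorm n by lra.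
(* a bound for N(y) that is known before y is chosen: y is bounded since
   |n| < 1 and N dominates the norm *)
pose nu0 := 3 / (1 - rnorm n) + 3.
have nu00 : 0 <= nu0 by rewrite addr_ge0// divr_ge0// ltW.
have err2 : 0 < err / 2 by lra.
have [eps1 eps10 state] := approximate_state nX nu00 err2.
pose eps := Num.min 1 (Num.min eps1 (err / 2)).
have eps0 : 0 < eps by rewrite !lt_min ltr01 eps10.
have [eps_1 eps_2 eps_3] : [/\ eps <= 1, eps <= eps1 & eps <= err / 2].
  by rewrite !ge_min !lexx !orbT.
have [y ny] := asym_conj_approx n1' eps0.
exists y; first by lra.
have y_le : rnorm y <= 3 / (1 - rnorm n).
  rewrite ler_pdivlMr//; have := realpart_functional_le n y.
  by have := asym_norm_ge y; have := asym_conj_ge2 n1'; lra.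
have N_le : asym_norm y <= nu0.
  have := realpart_functional_le n y; have := asym_conj_ge2 n1'.
  have : rnorm n * rnorm y <= rnorm y by rewrite ler_piMl ?rnorm_ge0.
  rewrite /nu0; lra.
have N_ge0 : 0 <= asym_norm y by apply: le_trans (asym_norm_ge y); exact: rnorm_ge0.
have [L [LD LZ Lq Ln Lid]] := asym_extension n1'.
pose r (S : bounded_op X X) : R := L (adjoint S y) S.
have rD S T : r (S + T) = r S + r T by rewrite /r adjointD LD.
have rZ (t : R) S : r (ofreal k t *: S) = t * r S by rewrite /r adjointZ LZ.
have r_split S : r S = realpart (n (adjoint S y)) + L 0 S.
  by rewrite -Ln -LD addr0 add0r.
have r_id : r id_op = realpart (n y) + L 0 id_op by rewrite r_split adjoint_id.
have r_le S : r S <= (asym_norm y + err / 2) * numerical_radius S.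
  apply: state; rewrite ?N_ge0//.
    move=> T c c0 Tc; apply: (le_trans (Lq _ _)); rewrite mulrC.
    exact: asym_shift_le.
  by rewrite r_id; lra.
have [phi phir phi_le] : exists2 phi : dual Lv,
    forall S, realpart (phi S) = r S & rnorm phi <= asym_norm y + err / 2.
  apply: functional_of_real_part => //; first by rewrite addr_ge0// ltW.
  by move=> S; rewrite rnorm_numradE; exact: r_le.
have LN S : L 0 (- S) = - L 0 S.
  have := LD 0 0 S (- S); rewrite addr0 subrr Ln linear0 realpart0; lra.
have r_compact S : J S -> r S = realpart (n (adjoint S y)).
  move=> JS; rewrite r_split.
  have h T : J T -> L 0 T <= 0.
    by move=> JT; apply: (le_trans (Lq _ _)); rewrite asym_compact.
  have JN : J (- S) by have := J_linear (-1) JS J0; rewrite addr0 scaleN1r.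
  by have := h _ JN; have := h _ JS; rewrite LN; lra.
have phi_compact S : J S -> phi S = tensor nX n y S.
  move=> JS; apply/eqP; rewrite -subr_eq0; apply/eqP; apply: (@rnorm_eq0 R k K^o).
  apply/eqP; rewrite eq_le rnorm_ge0 andbT; apply: (le_trans (rnorm_le_parts _)).
  have re0 T : J T -> realpart (phi T - tensor nX n y T) = 0.
    by move=> JT; rewrite realpartB phir r_compact// tensorE subrr.
  rewrite re0// normr0 add0r mulrBr.
  have JI : J (imag_unit *: S) by have := J_linear imag_unit JS J0; rewrite addr0.
  have := re0 _ JI; rewrite !linearZ /= => ->; by rewrite normr0.
have Pphi : P phi = P (tensor nX n y) := projection_eq kerP phi_compact.
have := normP phi; have := realpart_at_id_le (phi - P phi).
rewrite bounded_opBE realpartB phir Pphi.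
have := projection_tensor_ge PP kerP n y.
rewrite r_id.
have -> : realpart (P (tensor nX n y) (id_op : Lv)) = realpart (n y) + realpart (defect normP n y).
  by rewrite defectE realpartB; lra.
lra.
Qed.

(** An instance of [skew_le]: slopes of the conjugate at n are evaluations at an
    almost optimal y, and its oscillation is at most 2 since |w_p| <= 2. *)
Lemma asym_conj_norm n1 n2 : rnorm n1 = rnorm n2 -> rnorm n1 < 1 ->
  0 < rnorm (defect normP n1) -> asym_conj n1 <= asym_conj n2.
Proof.
have [G GE] := realify_linear (defect_linear normP).
rewrite -GE.
pose nrm (n : realify (dual (dual X))) : R := rnorm (n : dual (dual X)).
pose H (n : realify (dual (dual X))) : R := asym_conj (n : dual (dual X)).
have g0 : 0 <= (numerical_index X)^-1 + 1 by rewrite addr_ge0// invr_ge0 ltW.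
apply: (@skew_le R (realify (dual (dual X))) nrm G ((numerical_index X)^-1 + 1) 2 H) => //.
- by move=> a b; exact: ler_rnormD.
- by move=> a n; exact: rnormZr.
- by move=> n; rewrite /nrm GE; exact: defect_norm_le.
- by move=> s n; rewrite /nrm GE; exact: (defect_skew PP kerP normP s n).
- by move=> n /ltW; exact: asym_conj_le0.
- by move=> n /ltW; exact: asym_conj_ge2.
move=> n e n1' e0.
have [y y1 y2] := asym_conj_slope n1' e0.
have [l lE] := realpart_scalar y; exists l; split => [n' /ltW n'1|q qn].
  have y3 : realpart ((n' : dual (dual X)) y) - asym_norm y <= H n'.
    exact: (asym_conj_ge y n'1).
  rewrite (linearB l) !lE; move: y1 y3; rewrite -[asym_conj n]/(H n).
  set a := realpart _; set b := realpart _; set c := asym_norm _.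
  move: (H n) (H n') a b c => h h' a b c.
  lra.
rewrite !lE GE; apply: le_trans y2.
by apply: (le_trans (realpart_functional_le _ _)); rewrite ler_wpM2r ?rnorm_ge0.
Qed.

(** The hypotheses on N say that y is optimal for n, so that the conjugate at n
    is - d with d = 1 - Re n(y). Shrinking n to a n changes this to at most - a d. At
    (1 + hG) n, normalized, testing with y gives at least a (1 - d + h d) - 1 up
    to terms of order h^2. For a close to 1 and d > 0 the second value would be
    larger, against [asym_conj_norm]. *)
Lemma limit_pair_state n y : rnorm n <= 1 ->
  asym_norm y <= 1 ->
  (forall y', realpart (n y') + 1 - realpart (n y) <= asym_norm y') ->
  1 - realpart (n y) <= realpart (defect normP n y) ->
  1 <= realpart (n y).
Proof.
have arith1 (b c u v : R) : b * c <= c -> b * (v + 1 - u) <= b * c ->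
  b * v - c <= - (b * (1 - u)) by lra.
have arith2 (u v c : R) : u < v -> 0 <= u -> 1 + v <= c * (1 + u) -> 1 < c.
  move=> uv u0 vc; have u1 : 0 < 1 + u by lra.
  by rewrite -(ltr_pM2r u1); lra.
have arith3 (b c u v N h : R) : N <= 1 -> 1 < b * (1 + h * (1 - u)) ->
    b * (1 - u) <= c * (1 - u) -> b * (h * (1 - u)) <= b * (h * v) ->
  - (c * (1 - u)) < b * (u + h * v) - N by lra.
move=> n1 Ny Nge def_ge; rewrite leNgt; apply/negP => ny1.
pose d := 1 - realpart (n y); have d0 : 0 < d by rewrite subr_gt0.
set G := defect normP in def_ge *.
pose g := (numerical_index X)^-1 + 1.
have Gn0 : 0 < rnorm (G n).
  rewrite lt_def rnorm_ge0 andbT; apply/negP => /eqP /rnorm_eq0 Gn.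
  by move: def_ge; rewrite Gn (_ : (0 : dual (dual X)) y = 0)// realpart0 -/d; lra.
have nn0 : 0 < rnorm n.
  rewrite lt_def rnorm_ge0 andbT; apply/negP => /eqP n0.
  by have := defect_norm_le normP n; rewrite n0 mulr0 -/G; lra.
have g2 : 0 <= g ^+ 2 by exact: sqr_ge0.
(* small enough for the gain h d to exceed the normalization cost h^2 g^2 *)
pose h := d / (g ^+ 2 + 1).
have h0 : 0 < h by rewrite divr_gt0//; lra.
have hd : h * g ^+ 2 < d.
  have : h * (g ^+ 2 + 1) = d by rewrite divfK// gt_eqF//; lra.
  by rewrite mulrDr mulr1; lra.
have hhd : h ^+ 2 * g ^+ 2 < h * d by rewrite expr2 -mulrA ltr_pM2l.
have hhg0 : 0 <= h ^+ 2 * g ^+ 2 by rewrite mulr_ge0 ?sqr_ge0.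
pose s := (h ^+ 2 * g ^+ 2 + h * d) / 2.
have [s1 s2] : h ^+ 2 * g ^+ 2 < s /\ s < h * d by rewrite /s; split; lra.
pose a := (1 + s) / (1 + h * d).
have hdp : 0 < 1 + h * d by lra.
have a0 : 0 < a by rewrite divr_gt0//; lra.
have a1 : a < 1 by rewrite ltr_pdivrMr//; lra.
have aE : a * (1 + h * d) = 1 + s by rewrite divfK// gt_eqF.
pose m := n + ofreal k h *: G n.
have nm : rnorm n <= rnorm m := defect_skew PP kerP normP h n.
have mn : rnorm m <= (1 + h ^+ 2 * g ^+ 2) * rnorm n := defect_second_order PP kerP normP h n.
have m0 : 0 < rnorm m := lt_le_trans nn0 nm.
pose a' := a * rnorm n / rnorm m.
have a'0 : 0 < a' by rewrite divr_gt0// mulr_gt0.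
have a'm : a' * rnorm m = a * rnorm n by rewrite divfK// gt_eqF.
have a'a : a' <= a by rewrite ler_pdivrMr// ler_pM2l.
have aa' : a <= a' * (1 + h ^+ 2 * g ^+ 2).
  rewrite -(ler_pM2r nn0) -a'm -[leRHS]mulrA ler_pM2l//.
have norms : rnorm (ofreal k a' *: m) = rnorm (ofreal k a *: n).
  by rewrite !rnormZr !gtr0_norm.
have norm1 : rnorm (ofreal k a' *: m) < 1.
  rewrite norms rnormZr gtr0_norm//; apply: le_lt_trans a1.
  by rewrite ler_piMr// ltW.
have G1 : 0 < rnorm (G (ofreal k a' *: m)).
  rewrite /G defectZ rnormZr gtr0_norm// mulr_gt0//; apply: (lt_le_trans Gn0).
  have -> : defect normP m = G n + ofreal k h *: defect normP (G n).
    by rewrite /m addrC defect_linear addrC.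
  exact: (defect_skew PP kerP normP).
have Hle := asym_conj_norm norms norm1 G1.
suff : asym_conj (ofreal k a *: n) < asym_conj (ofreal k a' *: m).
  by rewrite ltNge Hle.
have Nge0 y' : 0 <= asym_norm y'.
  by apply: le_trans (asym_norm_ge y'); exact: rnorm_ge0.
have H2 : asym_conj (ofreal k a *: n) <= - (a * d).
  apply: asym_conj_le => y'; rewrite bounded_opZE realpart_ofrealZ.
  have := ler_wpM2l (ltW a0) (Nge y').
  by have := ler_piMl (Nge0 y') (ltW a1); exact: arith1.
have H1 : realpart ((ofreal k a' *: m) y) - asym_norm y <=
    asym_conj (ofreal k a' *: m).
  exact: (asym_conj_ge y (ltW norm1)).
apply: (le_lt_trans H2); apply: lt_le_trans H1.
rewrite bounded_opZE realpart_ofrealZ bounded_opDE realpartD bounded_opZE realpart_ofrealZ.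
have : a' * (h * d) <= a' * (h * realpart (G n y)).
  by rewrite ler_pM2l// ler_pM2l.
have := ler_wpM2r (ltW d0) a'a.
have : 1 < a' * (1 + h * d).
  apply: (arith2 _ _ _ s1); first exact: hhg0.
  by rewrite -aE; apply: le_trans (ler_wpM2r (ltW hdp) aa') _; rewrite mulrAC.
exact: (arith3 _ _ _ _ _ _ Ny).
Qed.

End asymptotic_norm.

(** * Farthest points *)

Section farthest.
Context {R : realType} {k : scalar_kind} {X : normedModType (scalar_field R k)}.
Variable nX : 0 < numerical_index X.
Local Notation K := (scalar_field R k).
Local Notation Lv := (numrad_op nX).
Local Notation ball := (numrad_compact_ball nX).
Implicit Types (T : Lv).

Lemma state_pairs_nonempty : state_pairs X !=set0.
Proof.
apply/set0P/negP => /eqP s0.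
suff : numerical_index X = 0 by move: nX => /[swap] ->; rewrite ltxx.
rewrite /numerical_index (_ : [set T | rnorm T = 1] = set0); first by rewrite image_set0 inf0.
apply/seteqP; split => // T /= T1.
have T0 : T = 0 by apply: (numerical_radius_eq0 nX); rewrite /numerical_radius s0 image_set0 sup0.
by move: T1; rewrite T0 rnorm0 => /eqP; rewrite eq_sym oner_eq0.
Qed.

(** The rank one operator of the state pair is given the phase opposite to the
    value of T there, so that both moduli add up in T - C. *)
Lemma rank_one_far T (p : dual X * X) : state_pairs X p -> exists2 C : Lv,
  ball C & rnorm (p.1 ((T : bounded_op X X) p.2)) + 1 <= rnorm (T - C).
Proof.
move=> sp; have [p1 p2 p12] := sp; set a := p.1 _.
have [c c1 ca] := phase a.
have c0 : c != 0.
  by apply/eqP => c0; move: c1; rewrite c0 rnorm0 => /eqP; rewrite eq_sym oner_eq0.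
have cV1 : rnorm (c^-1 : K^o) = 1.
  by have := rnorm_scalarM c c^-1; rewrite mulfV// rnorm1 c1 mul1r => <-.
(* c^-1 has the phase of the numerical value a, so a + c^-1 has modulus |a| + 1 *)
pose C : Lv := rank_one p.1 (- c^-1 *: p.2).
exists C.
  split; first exact: rank_one_compact.
  rewrite rnorm_numradE; apply: (le_trans (numerical_radius_le_opnorm _)).
  apply: (le_trans (opnorm_rank_one _ _)).
  by rewrite p1 rnormZ rnormN cV1 p2 !mulr1.
rewrite rnorm_numradE; apply: le_trans (le_numerical_radius _ sp).
have -> : p.1 ((T - C : bounded_op X X) p.2) = a + c^-1.
  rewrite bounded_opBE (linearB p.1) -/a.
  have -> : (C : bounded_op X X) p.2 = p.1 p.2 *: (- c^-1 *: p.2) by [].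
  rewrite p12 scale1r (linearZ_LR p.1) /= p12 -[- _ *: _]/(- c^-1 * 1) mulr1.
  by rewrite opprK.
have : rnorm (c * (a + c^-1) : K^o) = rnorm a + 1.
  rewrite mulrDr mulfV// ca -ofreal1 -ofrealD rnorm_ofreal// addr_ge0//.
  exact: rnorm_ge0.
by rewrite rnorm_scalarM c1 mul1r => ->.
Qed.

Lemma rnorm_ball_le T (C : Lv) : ball C -> rnorm (T - C) <= numerical_radius T + 1.
Proof.
move=> [_ C1]; apply: (le_trans (ler_rnormB _ _)).
by rewrite -[numerical_radius T](rnorm_numradE (nX := nX)) lerD2l.
Qed.

Lemma le_farthest_dist T (C : Lv) : ball C -> rnorm (T - C) <= farthest_dist T ball.
Proof. exact: (le_sup_image (fun C => @rnorm_ball_le T C)). Qed.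

Lemma farthest_distE T : farthest_dist T ball = numerical_radius T + 1.
Proof.
apply/eqP; rewrite eq_le; apply/andP; split.
  apply: sup_image_le => [|C]; last exact: rnorm_ball_le.
  by rewrite addr_ge0// numerical_radius_ge0.
rewrite -lerBrDr; apply: ge_sup.
  by have [p sp] := state_pairs_nonempty; exists (rnorm (p.1 ((T : bounded_op X X) p.2))), p.
move=> _ [p sp <-]; have [C bC TC] := rank_one_far T sp.
by rewrite lerBrDr; apply: (le_trans TC); exact: le_farthest_dist.
Qed.

Lemma attains_farthest T : attains_numerical_radius T -> has_farthest_point T ball.
Proof.
move=> [p sp pT]; have [C bC TC] := rank_one_far T sp; exists C => //.
apply/eqP; rewrite eq_le le_farthest_dist//= farthest_distE -pT.
exact: TC.
Qed.

End farthest.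

(** * Limits of states and the adjoint *)

Section evaluation_functional.
Context {R : realType} {k : scalar_kind} {X : normedModType (scalar_field R k)}.
Local Notation K := (scalar_field R k).

Lemma evaluation_bounded (x : X) :
  (fun y : dual X => y x : K^o) \in bounded_linear (dual X) K^o.
Proof.
apply/asboolP; split => [a y y'|]; first by rewrite bounded_opDE bounded_opZE.
exists (ofreal k (rnorm x)) => y.
by rewrite -!ofreal_rnorm -ofrealM ler_ofreal mulrC functional_le.
Qed.

Definition evaluation x : dual (dual X) := BoundedOp (evaluation_bounded x).

Lemma evaluationE x y : evaluation x y = y x. Proof. by []. Qed.

Lemma evaluation_norm_le x : rnorm (evaluation x) <= rnorm x.
Proof.
apply: functional_norm_le => [|y]; first exact: rnorm_ge0.
by rewrite evaluationE mulrC realpart_functional_le.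
Qed.

End evaluation_functional.

Section ultrafilter_values.
Context {R : realType} {k : scalar_kind} {I : Type} (U : set_system I) {FU : UltraFilter U}.
Local Notation K := (scalar_field R k).

Lemma limit_value_ge (f : I -> K) (a : K) (c : R) :
  (forall e, 0 < e -> U [set p | rnorm (f p - a : K^o) < e]) ->
  (forall e, 0 < e -> U [set p | c - e <= rnorm (f p : K^o)]) -> c <= rnorm (a : K^o).
Proof.
move=> fa fc; apply/ler_addgt0Pr => e e0.
have e2 : 0 < e / 2 by lra.
have [p [p1 p2]] := @filter_ex _ U _ _ (filterI (fa _ e2) (fc _ e2)).
by move: p1 p2; rewrite /mkset; have := rnorm_le_dist (f p : K^o) a; lra.
Qed.

Lemma limit_value_eq (f : I -> K) (a b : K) :
  (forall e, 0 < e -> U [set p | rnorm (f p - a : K^o) < e]) ->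
  (forall e, 0 < e -> U [set p | rnorm (f p - b : K^o) < e]) -> a = b.
Proof.
move=> fa fb; apply/eqP; rewrite -subr_eq0; apply/eqP; apply: (@rnorm_eq0 R k K^o).
apply/eqP; rewrite eq_le rnorm_ge0 andbT; apply/ler_addgt0Pr => e e0.
have e2 : 0 < e / 2 by lra.
have [p [p1 p2]] := @filter_ex _ U _ _ (filterI (fa _ e2) (fb _ e2)).
move: p1 p2; rewrite /mkset (rnorm_distC (f p : K^o) a).
by have := ler_rnormD (a - f p : K^o) (f p - b); rewrite addrA subrK; lra.
Qed.

End ultrafilter_values.

Section limit_states.
Context {R : realType} {k : scalar_kind} {X : normedModType (scalar_field R k)}.
Variable nX : 0 < numerical_index X.
Local Notation K := (scalar_field R k).
Local Notation Lv := (numrad_op nX).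
Local Notation J := (numrad_compact nX).

(** Directs the state pairs towards the supremum that defines the numerical
    radius, which need not be attained. *)
Lemma approximating_ultrafilter (T : bounded_op X X) :
  exists2 U : set_system (dual X * X)%type, UltraFilter U &
  U (state_pairs X) /\
  forall e, 0 < e -> U [set p : dual X * X | numerical_radius T - e <= rnorm (p.1 (T p.2))].
Proof.
pose B (e : R) := [set p : dual X * X | state_pairs X p /\ numerical_radius T - e <= rnorm (p.1 (T p.2))].
have FF : ProperFilter (filter_from [set e : R | 0 < e] B).
  apply: filter_from_proper; first apply: filter_from_filter.
  - by exists 1 => /=.
  - move=> a b /= a0 b0; exists (Num.min a b); first by rewrite lt_min a0.
    move=> p [sp pT]; split; split => //; apply: le_trans pT;
      by rewrite lerD2l lerN2 ge_min lexx ?orbT.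
  - move=> e /= e0; have [p0 sp0] := state_pairs_nonempty nX.
    have hs : has_sup [set rnorm (p.1 (T p.2)) | p in state_pairs X].
      split; first by exists (rnorm (p0.1 (T p0.2))), p0.
      by exists (opnorm T) => _ [p sp <-]; exact: numerical_radius_ub.
    have [_ [p sp <-] pT] := sup_adherent e0 hs.
    by exists p; split => //; exact: ltW.
have [U [UU FU]] := ultraFilterLemma FF.
exists U => //; split; first by apply: FU; exists 1 => [/=|p []].
by move=> e e0; apply: FU; exists e => // p [].
Qed.

Lemma farthest_adjoint_attains (T : Lv) : M_ideal J ->
  has_farthest_point T (numrad_compact_ball nX) ->
  attains_numerical_radius (adjoint (T : bounded_op X X)).
Proof.
move=> [[_ J0 JL] [P [PP kerP normP]]] [c [Jc c1] Tc].
rewrite farthest_distE rnorm_numradE in Tc.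
have [U FU [Us Ut]] := approximating_ultrafilter (T - c : bounded_op X X).
have Us1 : U [set p : dual X * X | rnorm p.1 <= 1].
  by apply: filterS Us => p [/= -> _ _].
have [xs xs1 xsP] := limit_functional ler01 Us1.
have Us2 : U [set p : dual X * X | rnorm (evaluation p.2) <= 1].
  by apply: filterS Us => p [/= _ <- _]; exact: evaluation_norm_le.
have [xss xss1 xssP] := limit_functional ler01 Us2.
have Us3 : U [set p : dual X * X | rnorm (tensor nX (evaluation p.2) p.1) <= 1].
  apply: filterS Us => p sp; apply: functional_norm_le => // S; rewrite mul1r rnorm_numradE.
  apply: (le_trans (realpart_le _)); rewrite tensorE.
  exact: (le_numerical_radius _ sp).
have [phi phi1 phiP] := limit_functional ler01 Us3.
pose w (p : dual X * X) := p.1 - xs.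
have w_le2 : U [set p | rnorm (w p) <= 2].
  apply: filterS Us1 => p; rewrite /mkset => p1.
  by have := ler_rnormB p.1 xs; rewrite /w; lra.
have w_vanish (x : X) e : 0 < e -> U [set p | rnorm (w p x : K^o) < e].
  by move=> e0; apply: filterS (xsP x e e0) => p; rewrite /mkset /w bounded_opBE.
(* c is compact, so phi and P phi agree at c; this forces |P phi| >= 1 >= |phi| *)
have phiTc : numerical_radius T + 1 <= rnorm (phi (T - c)).
  apply: (limit_value_ge (phiP (T - c))) => e e0; rewrite -Tc; exact: Ut.
have phiT_le : rnorm (phi T) <= numerical_radius T.
  apply: (le_trans (functional_le _ _)); rewrite rnorm_numradE.
  by rewrite ler_piMl ?numerical_radius_ge0.
have phic_le : rnorm (phi c) <= rnorm (P phi).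
  rewrite -(projection_agree PP kerP phi Jc); apply: (le_trans (functional_le _ _)).
  by rewrite ler_piMr ?rnorm_ge0.
have phiB : rnorm (phi (T - c)) <= rnorm (phi T) + rnorm (phi c).
  by rewrite (linearB phi) ler_rnormB.
have Pphi_le := projection_norm_le normP phi.
have phiT_ge : numerical_radius T <= rnorm (phi T) by lra.
have Pphi_ge : 1 <= rnorm (P phi) by lra.
have Pphi : P phi = phi.
  apply/eqP; rewrite eq_sym -subr_eq0; apply/eqP/rnorm_eq0.
  by have := normP phi; have := rnorm_ge0 (phi - P phi); lra.
have phi_compact (C : Lv) : J C -> phi C = tensor nX xss xs C.
  move=> JC; apply: (limit_value_eq (phiP C)) => e e0; rewrite tensorE.
  have e2 : 0 < e / 2 by lra.
  have Uc : U [set p | rnorm (adjoint C (w p)) < e / 2].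
    exact: (adjoint_compact_vanish JC w_le2 w_vanish e2).
  have Ux := xssP (adjoint C xs) _ e2.
  apply: filterS (filterI (filterI Us2 Uc) Ux) => p [[p1 p2] p3].
  move: p1 p2 p3; rewrite /mkset => p1 p2 p3; rewrite tensorE.
  have -> : p.1 = xs + w p by rewrite addrC subrK.
  rewrite (linearD (adjoint C)) (linearD (evaluation p.2)) addrAC.
  apply: (le_lt_trans (ler_rnormD _ _)).
  have := functional_le (evaluation p.2) (adjoint C (w p)).
  have : rnorm (evaluation p.2) * rnorm (adjoint C (w p)) <= rnorm (adjoint C (w p)).
    by rewrite ler_piMl ?rnorm_ge0.
  lra.
have tensorP : P (tensor nX xss xs) = phi by rewrite -[RHS]Pphi (projection_eq kerP phi_compact).
have phi_id : phi (id_op : Lv) = 1.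
  apply: (limit_value_eq (phiP (id_op : Lv))) => e e0; apply: filterS Us => p [_ _ p12].
  by rewrite /mkset tensorE adjoint_id evaluationE p12 subrr rnorm0.
have y_norm : asym_norm U w xs <= 1.
  rewrite asym_normE; apply: (@ulim_le _ _ U _ _ 1).
    by apply: filterS Us1 => p; rewrite /mkset /w addrC subrK ger0_norm ?rnorm_ge0.
  by apply: filterS Us1 => p; rewrite /mkset /w addrC subrK.
have y_optimal (y : dual X) : realpart (xss y) + 1 - realpart (xss xs) <= asym_norm U w y.
  apply/ler_addgt0Pr => e e0; have e2 : 0 < e / 2 by lra.
  rewrite -lerBlDr asym_normE//; apply: (@ulim_ge _ _ U _ _ (rnorm y + 2)).
    apply: filterS w_le2 => p; rewrite /mkset => wp; rewrite ger0_norm ?rnorm_ge0//.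
    by have := ler_rnormD y (w p); lra.
  apply: filterS (filterI Us (filterI (xssP y _ e2) (xssP xs _ e2))) => p.
  move=> [[_ p2 p12] [h1 h2]]; move: h1 h2; rewrite /mkset !evaluationE => h1 h2.
  have := realpart_functional_le (y + w p) p.2; rewrite p2 mulr1.
  rewrite bounded_opDE bounded_opBE p12 realpartD realpartB realpart1.
  have := normr_realpart_le (y p.2 - xss y); have := normr_realpart_le (xs p.2 - xss xs).
  rewrite !realpartB !ler_norml => /andP[a1 a2] /andP[b1 b2]; lra.
have def_ge : 1 - realpart (xss xs) <= realpart (defect normP xss xs).
  by rewrite defectE tensorP phi_id realpartB realpart1.
have re1 : 1 <= realpart (xss xs).
  exact: (limit_pair_state PP kerP J0 JL w_le2 w_vanish xss1 y_norm y_optimal def_ge).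
have prod_ge : 1 <= rnorm xss * rnorm xs.
  exact: le_trans re1 (realpart_functional_le _ _).
have xs_ge := rnorm_ge0 xs; have xss_ge := rnorm_ge0 xss.
have xs_eq : rnorm xs = 1.
  apply/eqP; rewrite eq_le xs1; apply: (le_trans prod_ge).
  by rewrite ler_piMl.
have xss_eq : rnorm xss = 1.
  by apply/eqP; rewrite eq_le xss1 -[rnorm xss]mulr1 -{2}xs_eq.
have val_eq1 : rnorm (xss xs) = 1.
  apply/eqP; rewrite eq_le (le_trans re1 (realpart_le _)) andbT.
  by apply: (le_trans (functional_le _ _)); rewrite xs_eq xss_eq mulr1.
have sp : state_pairs (dual X) (xss, xs).
  by split => //=; rewrite (realpart_maximal (a := xss xs)) ?val_eq1 ?ofreal1.
have tensor_eq : tensor nX xss xs = phi.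
  apply/eqP; rewrite -subr_eq0; apply/eqP/rnorm_eq0.
  have := normP (tensor nX xss xs); have := tensor_state nX sp; rewrite tensorP.
  by have := rnorm_ge0 (tensor nX xss xs - phi); lra.
exists (xss, xs) => //=; apply/eqP; rewrite eq_le (le_numerical_radius (adjoint _) sp)/=.
apply: (le_trans (numerical_radius_adjoint_le nX _)); apply: (le_trans phiT_ge).
by rewrite -tensor_eq tensorE.
Qed.

End limit_states.

Unset Implicit Arguments.

Theorem theorem2p17 (R : realType) (k : scalar_kind)
    (X : completeNormedModType (scalar_field R k)) (nX : 0 < numerical_index X) :
  [/\ forall T : numrad_op nX,
        farthest_dist T (numrad_compact_ball nX) = numerical_radius T + 1,
      forall T : numrad_op nX,
        attains_numerical_radius T ->
        has_farthest_point T (numrad_compact_ball nX)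
    & M_ideal (numrad_compact nX) ->
      forall T : numrad_op nX,
        has_farthest_point T (numrad_compact_ball nX) ->
        attains_numerical_radius (adjoint T)].
Proof.
split.
- exact: farthest_distE.
- exact: attains_farthest.
- by move=> JM T; exact: farthest_adjoint_attains.
Qed.
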